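(* Let $\{\gamma_{ij}:\mathbb{R}\to\mathbb{R}\}_{i,j\in\{1,\dots,p\},\, i\neq j}$ be a connected interconnection all of whose functions $\gamma_{ij}$ are locally Lipschitz. For $\omega>0$ consider the array of coupled harmonic oscillators $$\dot{q}_i=\omega p_i,\qquad \dot{p}_i=-\omega q_i+\sum_{j\neq i}\gamma_{ij}(p_j-p_i),\qquad i=1,2,\dots,p,$$ with $q_i,p_i$ real-valued, and let $\xi_i=[q_i\ p_i]^T\in\mathbb{R}^2$ denote the state of the $i$th oscillator. For each pair $(\Delta,\delta)$ of positive numbers, there exists $\omega^*>0$ such that for each $\omega\ge\omega^*$ the following hold for solutions of the array. (a) For each $r>\delta$ there exists $\varepsilon>0$ such that $$\max_{i,j}|\xi_i(0)-\xi_j(0)|\le\varepsilon\implies\max_{i,j}|\xi_i(t)-\xi_j(t)|\le r\quad\forall t\ge0.$$ (b) For each $\varepsilon<\Delta$ there exists $r>0$ such that $$\max_{i,j}|\xi_i(0)-\xi_j(0)|\le\varepsilon\implies\max_{i,j}|\xi_i(t)-\xi_j(t)|\le r\quad\forall t\ge0.$$ (c) For each $r<\Delta$ and $\varepsilon>\delta$ there exists $T>0$ such that $$\max_{i,j}|\xi_i(0)-\xi_j(0)|\le r\implies\max_{i,j}|\xi_i(t)-\xi_j(t)|\le\varepsilon\quad\forall t\ge T.$$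
   Context: $|\cdot|$ is the Euclidean norm. The number of oscillators is denoted $p$ (without subscript), while $p_i$ (with subscript) denotes a state variable of the $i$th oscillator. A function $\alpha:\mathbb{R}_{\ge0}\to\mathbb{R}_{\ge0}$ is of class $\mathcal{K}$ if it is continuous, zero at zero, and strictly increasing. Interconnection: a set of functions $\{\gamma_{ij}:\mathbb{R}\to\mathbb{R}\}$, $i,j=1,\dots,p$, $i\neq j$, is an interconnection if for all $i,j$ and all $s\in\mathbb{R}$: (i) $\gamma_{ij}(0)=0$ and $s\gamma_{ij}(s)\ge0$; (ii) either $\gamma_{ij}\equiv0$ (written $\gamma_{ij}=0$), or (written $\gamma_{ij}\neq 0$) there exists $\alpha$ of class $\mathcal{K}$ such that $|\gamma_{ij}(s)|\ge\alpha(|s|)$ for all $s$. Graph of an interconnection: the directed graph with nodes $n_1,\dots,n_p$ in which $(n_i,n_j)$ is an edge iff $\gamma_{ij}\neq0$. A directed path from $n_1$ to $n_\ell$ is a sequence of nodes $(n_1,\dots,n_\ell)$ with each $(n_k,n_{k+1})$ an edge. A directed graph is connected if it has a node to which there exists a directed path from every other node. An interconnection is connected if its graph is connected. *)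

(* Defs.v *)
From HB Require Import structures.
From mathcomp Require Import all_boot all_order all_algebra.
From mathcomp Require Import all_classical all_reals all_analysis.
Set Implicit Arguments.
Unset Strict Implicit.
Unset Printing Implicit Defensive.
Import Order.TTheory GRing.Theory Num.Theory.
Import numFieldNormedType.Exports.
Local Open Scope classical_set_scope.
Local Open Scope ring_scope.

(* A function on the nonnegative reals is represented by a function on R of
   which only the values on [0, +oo) matter. *)
Definition class_K (R : realType) (alpha : R -> R) : Prop :=
  [/\ {homo alpha : s / 0 <= s},
      {within [set s | 0 <= s], continuous alpha},
      alpha 0 = 0 &
      forall s t, 0 <= s -> s < t -> alpha s < alpha t].

(* The diagonal entries gamma i i are junk: nothing below depends on them. *)
Definition interconnection (R : realType) (n : nat)
    (gamma : 'I_n -> 'I_n -> R -> R) : Prop :=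
  forall i j, i != j ->
    (forall s, gamma i j 0 = 0 /\ 0 <= s * gamma i j s) /\
    (gamma i j = cst 0 \/
     exists2 alpha, class_K alpha & forall s, alpha `|s| <= `|gamma i j s|).

Definition edge (R : realType) (n : nat) (gamma : 'I_n -> 'I_n -> R -> R) :
    rel 'I_n :=
  [rel i j | (i != j) && `[< gamma i j <> cst 0 >]].

Definition connected_interconnection (R : realType) (n : nat)
    (gamma : 'I_n -> 'I_n -> R -> R) : Prop :=
  interconnection gamma /\
  exists r, forall i, i != r -> connect (edge gamma) i r.

Definition locally_lipschitz (R : realType) (f : R -> R) : Prop :=
  forall x : R, exists2 U, nbhs x U & [lipschitz f y | y in U].

(* Derivative relative to a domain A: on A = [0, +oo) it is the two-sided
   derivative at t > 0 and the right derivative at t = 0. *)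
Definition is_derive_within (R : realType) (A : set R) (f : R -> R)
    (t l : R) : Prop :=
  (f s - f t) / (s - t) @[s --> within A t^'] --> l.

(* Solutions on the time interval [0, +oo). *)
Definition array_solution (R : realType) (n : nat)
    (gamma : 'I_n -> 'I_n -> R -> R) (omega : R) (q p : 'I_n -> R -> R) : Prop :=
  forall i t, 0 <= t ->
    is_derive_within [set s | 0 <= s] (q i) t (omega * p i t) /\
    is_derive_within [set s | 0 <= s] (p i) t
      (- omega * q i t + \sum_(j < n | j != i) gamma i j (p j t - p i t)).

Definition xi (R : realType) (n : nat) (q p : 'I_n -> R -> R)
    (i : 'I_n) (t : R) : 'cV[R]_2 :=
  \col_(k < 2) if k == 0 then q i t else p i t.

(* The library norm on matrices is the sup norm, not the Euclidean one. *)
Definition enorm (R : realType) (m : nat) (v : 'cV[R]_m) : R :=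
  Num.sqrt (\sum_(k < m) v k 0 ^+ 2).

Definition max_dist (R : realType) (n : nat) (q p : 'I_n -> R -> R)
    (t : R) : R :=
  \big[Num.max/0]_(ij : 'I_n * 'I_n) enorm (xi q p ij.1 t - xi q p ij.2 t).

(* Main.v *)
Require Import Defs.
From HB Require Import structures.
From mathcomp Require Import all_boot all_order all_algebra.
From mathcomp Require Import all_classical all_reals all_analysis.
From mathcomp Require Import ring lra.
Set Implicit Arguments.
Unset Strict Implicit.
Unset Printing Implicit Defensive.
Import Order.TTheory GRing.Theory Num.Theory.
Import numFieldNormedType.Exports.
Local Open Scope classical_set_scope.
Local Open Scope ring_scope.

(** In the complex coordinate z_i = q_i + i p_i each uncoupled oscillator rotates
    rigidly with speed omega.  In the frame that rotates with it, and in the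
    time t = omega * (original time), the state x_i = (a_i, b_i) of oscillator i
    only moves through the coupling, at a speed of order h = 1 / omega:
    x_i' = h * n(t) * sum_j gamma_ij (<n(t), x_j - x_i>), where
    n(t) = (- sin t, cos t).  Rotations preserve distances, so it suffices to
    study the x_i; their mutual distances are measured by [spread_le], the
    largest extent of the configuration over all directions.

    Averaging ([frozen_average]).  If v = x_j - x_i is frozen during one
    rotation, the integral of n(t) gamma (<n(t), v>) is kappa * v with
    kappa >= 0: the component orthogonal to v integrates to zero because it is
    the derivative of a periodic function, and the component along v is the
    integral of a nonnegative function, bounded below on an interval where n(t)
    is nearly parallel to v.  So up to an error of order h ^ 2 one period moves
    each projection y_i = <u, x_i> by h * sum_j kappa_ij (y_j - y_i)
    ([period_step]): every x_i is attracted by those x_j that act on it.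

    Consensus ([consensus_contract]).  Along such steps the extreme values of
    the y_i do not spread, up to errors.  Let D be the spread and let the root
    start in the lower half, say.  Measured from the top, the root then keeps a
    margin at least D / 4 over a fixed span of the slow time h * t.  A neighbour
    of the root either is already well below the top, or is far from the root, in
    which case |gamma_ij| is bounded below by its class K minorant and the
    neighbour is pulled down at a definite rate.  Following a path to the root,
    at the end of the span every y_i is below the top by an amount beta that
    depends only on a lower bound for D.  The same span in every direction u
    makes the diameter drop by beta ([block_contraction]).

    The span consists of about 1 / h periods, so the errors accumulated over it
    are of order h.  For h small they are negligible against beta and delta.
    Hence, if the diameter is initially at most Delta, it decreases by beta / 2
    over each block of periods as long as it exceeds delta / 2, never exceeds its
    initial value by more than delta, and stays at most delta once it has been at
    most delta / 2 at the end of a block ([slow_practical_stability]). *)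

(** * Calculus on the line *)

Section RealTools.
Context (R : realType).
Implicit Types f F df : R -> R.

Lemma mean_value f df (a b : R) : a <= b ->
  (forall x, a <= x <= b -> is_derive x 1 f (df x)) ->
  exists2 c, a <= c <= b & f b - f a = df c * (b - a).
Proof.
move=> ab fdf.
have [x|x|c] := @MVT_segment R f df a b ab.
- by rewrite in_itv/= => /andP[/ltW ax /ltW xb]; apply: fdf; rewrite ax.
- apply: derivable_within_continuous x => x; rewrite in_itv/= => xab.
  by have [] := fdf x xab.
- by rewrite in_itv/=; exists c.
Qed.

Lemma mean_value_norm f df (a b B : R) : a <= b ->
  (forall x, a <= x <= b -> is_derive x 1 f (df x)) ->
  (forall x, a <= x <= b -> `|df x| <= B) ->
  `|f b - f a| <= B * (b - a).
Proof.
move=> ab fdf dfB; have [c cab ->] := mean_value ab fdf.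
rewrite normrM [X in _ * X]ger0_norm ?subr_ge0// ler_wpM2r ?subr_ge0//.
exact: dfB.
Qed.

Lemma antiderivative f (a : R) : continuous f ->
  exists F, forall x, a < x -> is_derive x 1 F (f x).
Proof.
move=> cf; exists (fun x => \int[lebesgue_measure]_(t in [set` `[a, x]]) (f t))%R.
move=> x ax.
have [] := @continuous_FTC1_closed R f a x (x + 1) _ _ ax (cf x).
- by rewrite ltrDl.
- apply: continuous_compact_integrable; first exact: segment_compact.
  exact: continuous_subspaceT.
- by move=> dF Ff; apply: DeriveDef => //; rewrite -derive1E.
Qed.

(** Connectedness of a segment, in a form that serves as an induction principle:
    it is used both to glue local Lipschitz bounds and to confine a trajectory
    to a region where its speed is controlled. *)
Lemma locally_constant_segment (P : R -> Prop) (a b : R) : a <= b ->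
  (forall x, a <= x <= b -> exists2 d, 0 < d &
     forall y z, a <= y <= b -> a <= z <= b ->
     `|x - y| < d -> `|x - z| < d -> P y -> P z) ->
  P a -> P b.
Proof.
move=> ab loc Pa.
pose S := [set x | a <= x <= b /\ P x].
have Sa : S a by split => //; rewrite lexx.
have ubS : ubound S b by move=> x [/andP[]].
have hS : has_sup S by split; [exists a|exists b].
have supab : a <= sup S <= b.
  by rewrite ub_le_sup//= ?ge_sup//; [exists a|exists b].
have [d d0 Hd] := loc _ supab.
have [y Sy yd] := sup_adherent d0 hS.
have ysup : y <= sup S by apply: ub_le_sup => //; exists b.
pose z := Num.min b (sup S + d / 2).
have [/andP[sa sb]] := (supab, Sy.1).
have zS : sup S <= z by rewrite le_min sb lerDl divr_ge0// ltW.
have zd : z <= sup S + d / 2 by rewrite ge_min lexx orbT.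
have zb : z <= b by rewrite ge_min lexx.
have Pz : P z.
  apply: (Hd y z) => //; last exact: Sy.2.
  - exact: Sy.1.
  - by rewrite zb (le_trans sa).
  - by rewrite ger0_norm ?subr_ge0//; lra.
  - by rewrite distrC ger0_norm ?subr_ge0//; lra.
have : z <= sup S.
  apply: ub_le_sup; first by exists b.
  by split => //; rewrite zb (le_trans sa).
have [zE|zE] : z = b \/ z = sup S + d / 2.
- by rewrite /z minEle; case: ifP; [left|right].
- by rewrite -zE.
- by rewrite zE; lra.
Qed.

Lemma locally_lipschitz_ball f x : locally_lipschitz f ->
  exists M d, [/\ 0 < M, 0 < d & forall y z, `|x - y| < d -> `|x - z| < d ->
    `|f y - f z| <= M * `|y - z|].
Proof.
move=> /(_ x)[U [d/= d0 dU] [M [Mr HM]]].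
exists (Num.max M 0 + 1), d; split=> //.
  by rewrite ltr_wpDl// le_max lexx orbT.
move=> y z xy xz.
have : M < Num.max M 0 + 1 by rewrite ltr_pwDr// le_max lexx.
by move=> /HM/(_ (y, z)) /=; apply; split; exact: dU.
Qed.

Lemma locally_lipschitz_continuous f : locally_lipschitz f -> continuous f.
Proof.
move=> fl x; have [M [d [M0 d0 H]]] := locally_lipschitz_ball x fl.
apply/cvgrPdist_le => /= e e0.
near=> t.
have tx : `|x - t| < d by near: t; apply: cvgr_dist_lt; [exact: cvg_id|].
apply: le_trans (H x t _ tx) _; first by rewrite subrr normr0.
rewrite mulrC -ler_pdivlMr//.
by near: t; apply: cvgr_dist_le; [exact: cvg_id|rewrite divr_gt0].
Unshelve. all: by end_near. Qed.

Lemma locally_lipschitz_segment f (r : R) : locally_lipschitz f ->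
  exists2 L, 0 < L & forall y z, `|y| <= r -> `|z| <= r ->
    `|f y - f z| <= L * `|y - z|.
Proof.
move=> fl.
have [r0|r0] := leP 0 r; last first.
  by exists 1 => // y z /le_lt_trans/(_ r0); rewrite normr_lt0.
(* On ordered pairs, Lipschitz bounds on two adjacent intervals add up. *)
pose P x := exists2 L, 0 < L & forall y z, - r <= y -> y <= z -> z <= x ->
    `|f y - f z| <= L * (z - y).
have PP : P r.
  apply: (@locally_constant_segment P (- r) r); first lra.
  - move=> x xr; have [M [d [M0 d0 H]]] := locally_lipschitz_ball x fl.
    exists d => // y z yr zr xy xz [L L0 HL].
    exists (Num.max L M); first by rewrite lt_max L0.
    move=> s t rs st tz.
    have HL' s' t' : - r <= s' -> s' <= t' -> t' <= y ->
        `|f s' - f t'| <= Num.max L M * (t' - s').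
      move=> ? ? ?; apply: (@le_trans _ _ (L * (t' - s'))); first exact: HL.
      by rewrite ler_wpM2r ?subr_ge0// le_max lexx.
    have HM' s' t' : y <= s' -> s' <= t' -> t' <= z ->
        `|f s' - f t'| <= Num.max L M * (t' - s').
      move=> ys' st' tz'; apply: (@le_trans _ _ (M * (t' - s'))).
        rewrite -[X in _ * X]ger0_norm ?subr_ge0// (distrC t').
        move: xy xz; rewrite !ltr_distl => /andP[? ?] /andP[? ?].
        by apply: H; rewrite ltr_distl; apply/andP; split; lra.
      by rewrite ler_wpM2r ?subr_ge0// le_max lexx orbT.
    have [ty|yt] := leP t y; first exact: HL'.
    have [sy|ys] := leP s y; last exact: HM' (ltW ys) _ _.
    have -> : f s - f t = (f s - f y) + (f y - f t) by ring.
    apply: le_trans (ler_normD _ _) _.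
    have := HL' s y rs sy (lexx _).
    have := HM' y t (lexx _) (ltW yt) tz.
    lra.
  - exists 1 => // y z ry yz zr.
    have -> : y = z by apply/eqP; rewrite eq_le yz (le_trans zr).
    by rewrite !subrr normr0 mulr0.
have [L L0 HL] := PP.
exists L => // y z.
rewrite (ler_norml y) (ler_norml z) => /andP[y1 y2] /andP[z1 z2].
have [yz|/ltW zy] := leP y z.
  by rewrite [X in _ * X]distrC [X in _ * X]ger0_norm ?subr_ge0//; exact: HL.
by rewrite distrC [X in _ * X]ger0_norm ?subr_ge0//; exact: HL.
Qed.

(** Extending by the tangent line at 0 replaces the one-sided derivative at 0 by
    a two-sided one, so that the usual calculus of derivatives applies on the
    closed half-line. *)
Lemma extend_derive f df :
  (forall t, 0 <= t -> is_derive_within [set s | 0 <= s] f t (df t)) ->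
  exists2 F : R -> R, forall t : R, 0 <= t -> F t = f t &
    forall t : R, 0 <= t -> is_derive t 1 F (df t).
Proof.
move=> fdf.
pose F t := if 0 <= t then f t else f 0 + t * df 0.
exists F => [t t0|t t0]; first by rewrite /F t0.
suff H : h^-1 *: ((F \o shift t) (h *: 1) - F t) @[h --> 0^'] --> df t.
  by split; [apply/cvg_ex; exists (df t)|exact/cvg_lim].
apply/cvgrPdist_le => /= e e0.
have /cvgrPdist_le/(_ e e0) := fdf t t0.
move=> [d/= d0 dH].
have [d' d'0 [d'd d't]] : exists2 d', 0 < d' & d' <= d /\ (0 < t -> d' <= t).
  have [tp|tn] := ltP 0 t.
    exists (Num.min d t); first by rewrite lt_min d0.
    by split; rewrite ?ge_min ?lexx ?orbT.
  by exists d.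
exists d' => //= h; rewrite /ball_/= sub0r normrN => hd h0.
rewrite /shift/= [h *: 1]mulr1 /F t0.
have [th|th] := leP 0 (h + t).
  have := dH (h + t); rewrite /ball_/= opprD addrCA subrr addr0 normrN.
  rewrite addrK mulrC; apply => //.
  - exact: lt_le_trans hd d'd.
  - by apply: contra_neq h0 => ht; rewrite -(addrK t h) ht subrr.
have tz : t = 0.
  apply/eqP; rewrite eq_le t0 andbT leNgt; apply/negP => tp.
  move: hd; rewrite ltr_norml => /andP[]; have := d't tp; lra.
move: h0 => /= h0.
rewrite tz addr0 addrAC subrr add0r [_ *: _]mulrA mulVf// mul1r subrr normr0.
exact: ltW.
Qed.

End RealTools.

(** * Discrete consensus on a rooted graph *)

(** One Euler step, of size [h], of a weighted consensus dynamics on the graph [e],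
    as an inequality.  The weights may depend on the state and vanish when two
    neighbours agree; they are only bounded below, through [c], when the
    neighbour is above by a definite gap.  The inequality lets accumulated
    errors be absorbed in a time-dependent shift of [z]. *)
Definition supersolution_step (R : realType) n (h K : R) (e : rel 'I_n)
    (c : 'I_n -> 'I_n -> R -> R) (z z' : 'I_n -> R) : Prop :=
  forall i, exists kappa : 'I_n -> R,
    [/\ forall j, j != i -> 0 <= kappa j <= K,
        forall j eta, e i j -> 0 < eta -> eta <= z j - z i ->
          c i j eta <= kappa j &
        z i + h * (\sum_(j < n | j != i) kappa j * (z j - z i)) <= z' i].

Section Supersolutions.
Context (R : realType) (n : nat) (h K : R) (e : rel 'I_n).
Context (c : 'I_n -> 'I_n -> R -> R).
Hypotheses (h0 : 0 < h) (K0 : 0 < K).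

Lemma supersolution_step_bound (z z' : 'I_n -> R) i S :
  supersolution_step h K e c z z' -> (forall j, 0 <= z j) ->
  (forall kappa : 'I_n -> R, (forall j, j != i -> 0 <= kappa j) ->
    (forall j eta, e i j -> 0 < eta -> eta <= z j - z i ->
      c i j eta <= kappa j) ->
    S <= \sum_(j < n | j != i) kappa j * z j) ->
  (1 - h * (n%:R * K)) * z i + h * S <= z' i.
Proof.
move=> /(_ i)[k [k0K kc zz']] z0 /(_ k) SE.
apply: le_trans zz'.
under eq_bigr do rewrite mulrBr.
rewrite sumrB -mulr_suml.
have kK : \sum_(j < n | j != i) k j <= n%:R * K.
  apply: (@le_trans _ _ (\sum_(j < n) K)); last first.
    by rewrite sumr_const card_ord mulr_natl.
  rewrite big_mkcond/=; apply: ler_sum => l _.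
  by case: ifPn => [/k0K/andP[]//|_]; exact: ltW.
have kKz : (\sum_(j < n | j != i) k j) * z i <= n%:R * K * z i.
  exact: ler_wpM2r.
have {}SE : S <= \sum_(j < n | j != i) k j * z j.
  by apply: SE => // j /k0K/andP[].
have : h * (S - n%:R * K * z i) <=
  h * (\sum_(i0 < n | i0 != i) k i0 * z i0 - (\sum_(j < n | j != i) k j) * z i).
  by rewrite ler_pM2l//; lra.
lra.
Qed.

Lemma supersolution_step_decay (z z' : 'I_n -> R) i :
  supersolution_step h K e c z z' -> (forall j, 0 <= z j) ->
  (1 - h * (n%:R * K)) * z i <= z' i.
Proof.
move=> zz' z0; rewrite -[leLHS]addr0 -[X in _ + X](mulr0 h).
apply: (@supersolution_step_bound _ _ _ 0 zz' z0) => k k0 _.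
by apply: sumr_ge0 => l li; apply: mulr_ge0 => //; exact: k0.
Qed.

Lemma supersolution_step_pull (z z' : 'I_n -> R) i j eta :
  supersolution_step h K e c z z' -> (forall j, 0 <= z j) ->
  e i j -> 0 < eta -> eta <= z j - z i ->
  (1 - h * (n%:R * K)) * z i + h * (c i j eta * z j) <= z' i.
Proof.
move=> zz' z0 eij eta0 etaz.
have ji : j != i by apply: contraTneq etaz => ->; rewrite subrr -ltNge.
apply: (supersolution_step_bound zz' z0) => k k0 kc.
rewrite (bigD1 j)//= -[leLHS]addr0; apply: lerD.
  by apply: ler_wpM2r => //; exact: kc.
by apply: sumr_ge0 => l /andP[li _]; apply: mulr_ge0 => //; exact: k0.
Qed.

Context (N : nat) (z : nat -> 'I_n -> R).
Hypothesis zstep : forall k, (k < N)%N -> supersolution_step h K e c (z k) (z k.+1).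
Hypothesis z0 : forall i, 0 <= z 0 i.
Hypothesis hN : h * N%:R * (n%:R * K) <= 1 / 2.

Let x := h * (n%:R * K).
Let nK0 : 0 <= n%:R * K. Proof. by rewrite mulr_ge0// ltW. Qed.
Let x0 : 0 <= x. Proof. by rewrite mulr_ge0// ltW. Qed.
Let mx m : (m <= N)%N -> m%:R * x <= 1 / 2.
Proof.
move=> mN; apply: le_trans hN; rewrite /x mulrA ler_wpM2r//.
by rewrite mulrC ler_wpM2l ?ler_nat ?ltW.
Qed.

Lemma supersolution_ge0 k i : (k <= N)%N -> 0 <= z k i.
Proof.
elim: k i => [//|k IH] i kN.
apply: le_trans (supersolution_step_decay i (zstep kN) (fun j => IH j (ltnW kN))).
apply: mulr_ge0; last exact: IH (ltnW kN).
have := @mx 1%N (leq_trans (ltn0Sn k) kN); rewrite mul1r /x; lra.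
Qed.

(** The horizon [hN] is so short that no value can lose more than half of itself,
    by Bernoulli's inequality. *)
Lemma supersolution_half k l i : (k <= l <= N)%N -> z k i / 2 <= z l i.
Proof.
move=> /andP[kl lN].
have zk0 : 0 <= z k i by exact: supersolution_ge0 (leq_trans kl lN).
have H m : (k + m <= N)%N -> (1 - m%:R * x) * z k i <= z (k + m)%N i.
  elim: m => [|m IH] kmN; first by rewrite mul0r subr0 mul1r addn0.
  rewrite addnS in kmN.
  rewrite addnS.
  apply: le_trans (supersolution_step_decay i (zstep kmN)
    (fun j => supersolution_ge0 j (ltnW kmN))).
  have x1 := @mx 1%N (leq_trans (ltn0Sn _) kmN).
  apply: (@le_trans _ _ ((1 - x) * ((1 - m%:R * x) * z k i))); last first.
    by apply: ler_wpM2l; [rewrite mul1r in x1; lra|exact: IH (ltnW kmN)].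
  rewrite mulrA ler_wpM2r// -natr1 -subr_ge0.
  have -> : (1 - x) * (1 - m%:R * x) - (1 - (m%:R + 1) * x) = m%:R * (x * x).
    by ring.
  by apply: mulr_ge0 => //; exact: mulr_ge0.
have := H (l - k)%N; rewrite subnKC// => /(_ lN).
apply: le_trans.
rewrite mulrC; apply: ler_wpM2r => //.
have := @mx (l - k)%N (leq_trans (leq_subr _ _) lN); lra.
Qed.

(** A level [mu] held by [j] passes to a node [i] that [j] influences.  Either [i]
    reaches [mu / 2] at some time, and then keeps half of it; or the gap
    between [i] and [j] stays above [mu / 2], so that the weight of the edge stays
    above [c i j (mu / 2)] and [i] rises linearly for a time [S]. *)
Lemma supersolution_edge i j mu k P S :
  e i j -> 0 < mu -> 0 < c i j (mu / 2) -> S <= h * P%:R -> (k + P <= N)%N ->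
  (forall l, (k <= l <= N)%N -> mu <= z l j) ->
  forall l, (k + P <= l <= N)%N ->
  Num.min (mu / 4) (S * c i j (mu / 2) * mu / 4) <= z l i.
Proof.
move=> eij mu0 c0 hP kPN zj l /andP[kPl lN]; rewrite ge_min.
have [[m [mP zm]]|] :=
    pselect (exists m, (m < P)%N /\ mu / 2 <= z (k + m)%N i).
  apply/orP; left.
  have : z (k + m)%N i / 2 <= z l i.
    by apply: supersolution_half; rewrite lN (leq_trans _ kPl)// leq_add2l ltnW.
  lra.
move=> Hm; apply/orP; right.
have small m : (m < P)%N -> z (k + m)%N i < mu / 2.
  by move=> mP; rewrite ltNge; apply/negP => zm; apply: Hm; exists m.
have H m : (m <= P)%N -> m%:R * (h * (c i j (mu / 2) * mu)) / 2 <= z (k + m)%N i.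
  move=> mP.
  suff : (1 - m%:R * x) * (m%:R * (h * (c i j (mu / 2) * mu))) <= z (k + m)%N i.
    apply: le_trans; rewrite mulrC ler_wpM2r//.
      by rewrite !mulr_ge0// ltW.
    by have := @mx m (leq_trans mP (leq_trans (leq_addl _ _) kPN)); lra.
  elim: m mP => [|m IH] mP.
    by rewrite !mul0r mulr0 supersolution_ge0// addn0 (leq_trans _ kPN)// leq_addr.
  have kmN : (k + m < N)%N by rewrite (leq_trans _ kPN)// ltn_add2l.
  have kmNS : (k <= k + m <= N)%N by rewrite leq_addr ltnW.
  have pull := @supersolution_step_pull (z (k + m)%N) (z (k + m).+1) i j (mu / 2)
    (zstep kmN) (fun j => supersolution_ge0 j (ltnW kmN)) eij.
  rewrite addnS; apply: le_trans (pull _ _); last 2 first.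
  - by rewrite divr_gt0.
  - by have := small m mP; have := zj _ kmNS; lra.
  have x1 := @mx 1%N (leq_trans (ltn0Sn _) kmN); rewrite mul1r in x1.
  rewrite -/x; set q := h * (c i j (mu / 2) * mu).
  have q0 : 0 <= q by rewrite !mulr_ge0// ltW.
  apply: (@le_trans _ _ ((1 - x) * ((1 - m%:R * x) * (m%:R * q)) + q)).
    rewrite -subr_ge0 -natr1.
    have -> : (1 - x) * ((1 - m%:R * x) * (m%:R * q)) + q -
       (1 - (m%:R + 1) * x) * ((m%:R + 1) * q)
       = q * ((m%:R + 1) * x + m%:R * m%:R * (x * x)) by ring.
    have xx0 : 0 <= x * x by exact: mulr_ge0.
    by apply: mulr_ge0 => //; apply: addr_ge0; apply: mulr_ge0 => //;
      rewrite ?mulr_ge0 ?addr_ge0.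
  apply: lerD.
    by apply: ler_wpM2l; [lra|exact: IH (ltnW mP)].
  by rewrite /q ler_pM2l// ler_pM2l//; exact: zj.
have : z (k + P)%N i / 2 <= z l i by apply: supersolution_half; rewrite kPl.
apply: le_trans.
have := H P (leqnn P).
suff : S * (c i j (mu / 2) * mu) <= P%:R * (h * (c i j (mu / 2) * mu)) by lra.
by rewrite mulrA (mulrC P%:R) ler_wpM2r// mulr_ge0// ltW.
Qed.

End Supersolutions.

(** The level [m] is chosen before the step size and the solution: this is what
    makes the final contraction uniform.  Each edge of the path costs [P] steps,
    a slow time at least [S]. *)
Lemma supersolution_path (R : realType) (n : nat) (K S : R) (e : rel 'I_n)
    (c : 'I_n -> 'I_n -> R -> R) (r : 'I_n) (mu : R) (p : seq 'I_n) (i : 'I_n) :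
  0 < K -> 0 < S -> 0 < mu ->
  (forall i j eta, e i j -> 0 < eta -> 0 < c i j eta) ->
  path e i p -> last i p = r ->
  exists2 m, 0 < m & forall (h : R) (P N : nat) (z : nat -> 'I_n -> R),
    0 < h -> S <= h * P%:R -> h * N%:R * (n%:R * K) <= 1 / 2 ->
    (forall k, (k < N)%N -> supersolution_step h K e c (z k) (z k.+1)) ->
    (forall i, 0 <= z 0 i) -> mu <= z 0 r -> (size p * P <= N)%N ->
    forall k, (size p * P <= k <= N)%N -> m <= z k i.
Proof.
move=> K0 S0 mu0 c0; elim: p i => [|j p IH] i /=.
  move=> _ ->; exists (mu / 2); first by rewrite divr_gt0.
  move=> h P N z h0 _ hN zs z0 zr _ k kN.
  have /(_ 0 k r kN) := supersolution_half h0 K0 zs z0 hN; lra.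
move=> /andP[eij /(IH j){}IH] /IH[m m0 {}IH].
exists (Num.min (m / 4) (S * c i j (m / 2) * m / 4)).
  by rewrite lt_min !(divr_gt0, mulr_gt0)// c0// divr_gt0.
move=> h P N z h0 hP hN zs z0 zr pN.
have pN' : (size p * P + P <= N)%N by rewrite addnC -mulSn.
have zj := IH h P N z h0 hP hN zs z0 zr (leq_trans (leq_addr _ _) pN').
rewrite mulSn addnC.
apply: (@supersolution_edge _ _ _ _ _ _ h0 K0 N z zs z0 hN i j m (size p * P)) => //.
by rewrite c0// divr_gt0.
Qed.

Lemma supersolution_rise (R : realType) (n : nat) (K S : R) (e : rel 'I_n)
    (c : 'I_n -> 'I_n -> R -> R) (r : 'I_n) (mu : R) :
  0 < K -> 0 < S -> 0 < mu ->
  (forall i j eta, e i j -> 0 < eta -> 0 < c i j eta) ->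
  (forall i, i != r -> connect e i r) ->
  exists2 m, 0 < m & forall (h : R) (P : nat) (z : nat -> 'I_n -> R),
    0 < h -> S <= h * P%:R -> h * (n * P)%:R * (n%:R * K) <= 1 / 2 ->
    (forall k, (k < n * P)%N -> supersolution_step h K e c (z k) (z k.+1)) ->
    (forall i, 0 <= z 0 i) -> mu <= z 0 r ->
    forall i, m <= z (n * P)%N i.
Proof.
move=> K0 S0 mu0 c0 er.
have /choice[f Hf] i : exists m, 0 < m /\
    forall (h : R) (P : nat) (z : nat -> 'I_n -> R),
    0 < h -> S <= h * P%:R -> h * (n * P)%:R * (n%:R * K) <= 1 / 2 ->
    (forall k, (k < n * P)%N -> supersolution_step h K e c (z k) (z k.+1)) ->
    (forall i, 0 <= z 0 i) -> mu <= z 0 r -> m <= z (n * P)%N i.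
  have [p [pp lp pn]] : exists p, [/\ path e i p, last i p = r & (size p <= n)%N].
    have [->|/er/connectP[p pp ->]] := eqVneq i r; first by exists nil.
    case/shortenP: pp => p' pp' up' _; exists p'; split=> //.
    have := max_card (mem (i :: p')).
    by rewrite (card_uniqP up') card_ord; exact: ltnW.
  have [m m0 Hm] := supersolution_path K0 S0 mu0 c0 pp lp.
  exists m; split => // h P z h0 hP hN zs z0 zr.
  by apply: (Hm h P (n * P)%N z) => //; rewrite ?leqnn ?andbT leq_mul2r pn orbT.
exists (\big[Num.min/1]_(i < n) f i).
  by apply: lt_bigmin => // i _; exact: (Hf i).1.
move=> h P z h0 hP hN zs z0 zr i.
apply: le_trans ((Hf i).2 h P z h0 hP hN zs z0 zr).
exact: bigmin_le_cond.
Qed.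

(** The exact averaged dynamics up to an error [eps].  Unlike
    [supersolution_step] it is symmetric under [y |-> - y], so that lower and
    upper bounds are obtained from the same lemmas. *)
Definition consensus_step (R : realType) n (h K eps : R) (e : rel 'I_n)
    (c : 'I_n -> 'I_n -> R -> R) (y y' : 'I_n -> R) : Prop :=
  forall i, exists kappa : 'I_n -> R,
    [/\ forall j, j != i -> 0 <= kappa j <= K,
        forall j eta, e i j -> 0 < eta -> eta <= `|y j - y i| ->
          c i j eta <= kappa j &
        `|y' i - (y i + h * \sum_(j < n | j != i) kappa j * (y j - y i))|
          <= eps].

Section Consensus.
Context (R : realType) (n : nat) (h K eps : R) (e : rel 'I_n).
Context (c : 'I_n -> 'I_n -> R -> R).

Lemma consensus_stepN (y y' : 'I_n -> R) :
  consensus_step h K eps e c y y' ->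
  consensus_step h K eps e c (fun i => - y i) (fun i => - y' i).
Proof.
move=> yy' i; have [k [k0 kc ky]] := yy' i; exists k; split => //.
  by move=> j eta eij eta0; rewrite -opprD normrN; exact: kc.
under eq_bigr do rewrite -opprD mulrN.
by rewrite sumrN mulrN -opprD -opprD normrN.
Qed.

Lemma consensus_step_super (y y' : 'I_n -> R) a :
  consensus_step h K eps e c y y' ->
  supersolution_step h K e c (fun i => y i + a) (fun i => y' i + (a + eps)).
Proof.
move=> yy' i; have [k [k0 kc ky]] := yy' i; exists k; split => //.
  move=> j eta eij eta0.
  rewrite [X in eta <= X -> _](_ : _ = y j - y i); last by ring.
  by move=> etay; apply: kc => //; rewrite (le_trans etay)// ler_norm.
under eq_bigr => j _.
  rewrite [X in _ * X](_ : _ = y j - y i); last by ring.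
  over.
move: ky; rewrite ler_norml => /andP[]; lra.
Qed.

Context (N : nat) (y : nat -> 'I_n -> R).
Hypothesis ystep :
  forall k, (k < N)%N -> consensus_step h K eps e c (y k) (y k.+1).

Lemma consensus_steps_super m k : (k < N)%N ->
  supersolution_step h K e c (fun i => y k i + (k%:R * eps - m))
    (fun i => y k.+1 i + (k.+1%:R * eps - m)).
Proof.
move=> kN.
have -> : k.+1%:R * eps - m = (k%:R * eps - m) + eps by rewrite -natr1; ring.
exact: consensus_step_super (ystep kN).
Qed.

Hypotheses (h0 : 0 < h) (K0 : 0 < K).

Lemma consensus_floor m k i : h * N%:R * (n%:R * K) <= 1 / 2 ->
  (forall i, m <= y 0 i) -> (k <= N)%N -> m - k%:R * eps <= y k i.
Proof.
move=> hN ym kN.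
have := @supersolution_ge0 _ _ _ _ _ _ h0 K0 N
  (fun k i => y k i + (k%:R * eps - m)) (@consensus_steps_super m) _ hN k i kN.
move=> /(_ _)/wrap[j|]; last by lra.
by rewrite mul0r; have := ym j; lra.
Qed.

End Consensus.

Lemma spread_interval (R : realType) (n : nat) (y : 'I_n -> R) (D : R) (i : 'I_n) :
  (forall i j, y i - y j <= D) -> exists m, forall j, m <= y j <= m + D.
Proof.
move=> yD; exists (y [arg min_(j < i) y j]%O) => j; apply/andP; split.
  by case: arg_minP => // k _; exact.
by have := yD j [arg min_(j < i) y j]%O; lra.
Qed.

Lemma consensus_spread (R : realType) (n : nat) (h K eps D : R) (e : rel 'I_n)
    (c : 'I_n -> 'I_n -> R -> R) (N : nat) (y : nat -> 'I_n -> R) :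
  0 < h -> 0 < K -> h * N%:R * (n%:R * K) <= 1 / 2 ->
  (forall k, (k < N)%N -> consensus_step h K eps e c (y k) (y k.+1)) ->
  (forall i j, y 0%N i - y 0%N j <= D) ->
  forall k i j, (k <= N)%N -> y k i - y k j <= D + k%:R * eps *+ 2.
Proof.
move=> h0 K0 hN ys yD k i j kN.
have yNs l (lN : (l < N)%N) := consensus_stepN (ys l lN).
have [m ym] := spread_interval i yD.
have := @consensus_floor _ _ _ _ _ _ _ _ _ ys h0 K0 m k j hN.
move=> /(_ _ kN)/wrap[l|]; first by case/andP: (ym l).
have := @consensus_floor _ _ _ _ _ _ _ _ _ yNs h0 K0 (- (m + D)) k i hN.
by move=> /(_ _ kN)/wrap[l|]; [rewrite lerN2; case/andP: (ym l)|lra].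
Qed.

(** The root lies in the lower or in the upper half of the interval spanned by
    the initial values.  In the first case all values leave the top, in the
    second the bottom, while the opposite end does not move by more than the
    accumulated errors. *)
Lemma consensus_contract (R : realType) (n : nat) (K S : R) (e : rel 'I_n)
    (c : 'I_n -> 'I_n -> R -> R) (r : 'I_n) (D0 : R) :
  0 < K -> 0 < S -> 0 < D0 ->
  (forall i j eta, e i j -> 0 < eta -> 0 < c i j eta) ->
  (forall i, i != r -> connect e i r) ->
  exists2 m, 0 < m & forall (h eps D : R) (P : nat) (y : nat -> 'I_n -> R),
    0 < h -> S <= h * P%:R -> h * (n * P)%:R * (n%:R * K) <= 1 / 2 ->
    (forall k, (k < n * P)%N -> consensus_step h K eps e c (y k) (y k.+1)) ->
    D0 <= D -> (forall i j, y 0%N i - y 0%N j <= D) ->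
    forall i j, y (n * P)%N i - y (n * P)%N j <= D - m + (n * P)%:R * eps *+ 2.
Proof.
move=> K0 S0 D00 c0 er.
have mu0 : 0 < D0 / 2 by rewrite divr_gt0.
have [m m0 Hm] := supersolution_rise K0 S0 mu0 c0 er; exists m => //.
move=> h eps D P y h0 hP hN ys D0D yD i j.
have yNs k (kN : (k < n * P)%N) := consensus_stepN (ys k kN).
have [a ya] := spread_interval r yD.
have yaD l : - (a + D) <= - y 0%N l by rewrite lerN2; case/andP: (ya l).
have {}ya l : a <= y 0%N l by case/andP: (ya l).
have [ry|ry] := leP (a + D / 2) (y 0%N r).
  have := Hm h P (fun k i => y k i + (k%:R * eps - a)) h0 hP hN
    (consensus_steps_super ys a) _ _ j.
  move=> /(_ _ _)/wrap[l||].
  - by rewrite mul0r; have := ya l; lra.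
  - by rewrite mul0r; lra.
  have := @consensus_floor _ _ _ _ _ _ _ _ _ yNs h0 K0 _ (n * P) i hN yaD.
  by move=> /(_ (leqnn _)); lra.
have := Hm h P (fun k i => - y k i + (k%:R * eps - (- (a + D)))) h0 hP hN
    (consensus_steps_super yNs _) _ _ i.
move=> /(_ _ _)/wrap[l||].
- by rewrite mul0r; have := yaD l; lra.
- by rewrite mul0r; lra.
have := @consensus_floor _ _ _ _ _ _ _ _ _ ys h0 K0 a (n * P) j hN ya (leqnn _).
lra.
Qed.

(** * Averaging the coupling over one rotation *)

Section RotatingFrame.
Context (R : realType).

(** Laboratory coordinates of the vector (v1, v2) of the frame that has turned by
    the angle [t]; [labp v1 v2 t] is its scalar product with (- sin t, cos t). *)
Definition labq (v1 v2 t : R) := cos t * v1 + sin t * v2.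
Definition labp (v1 v2 t : R) := cos t * v2 - sin t * v1.

Lemma lab_norm (v1 v2 t : R) :
  labq v1 v2 t ^+ 2 + labp v1 v2 t ^+ 2 = v1 ^+ 2 + v2 ^+ 2.
Proof.
rewrite /labq /labp -[v1 ^+ 2 + _]mul1r -(cos2Dsin2 t); ring.
Qed.

Lemma is_derive_labp_comp (f g : R -> R) (t df dg : R) :
  is_derive t 1 f df -> is_derive t 1 g dg ->
  is_derive t 1 (fun t => labp (f t) (g t) t) (labp df dg t - labq (f t) (g t) t).
Proof.
move=> ? ?; rewrite (_ : (fun _ => _) = (@cos R * g) - (@sin R * f))//.
by apply: is_derive_eq; rewrite /labp /labq /GRing.scale/=; ring.
Qed.

Lemma is_derive_labq_comp (f g : R -> R) (t df dg : R) :
  is_derive t 1 f df -> is_derive t 1 g dg ->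
  is_derive t 1 (fun t => labq (f t) (g t) t) (labq df dg t + labp (f t) (g t) t).
Proof.
move=> ? ?; rewrite (_ : (fun _ => _) = (@cos R * f) + (@sin R * g))//.
by apply: is_derive_eq; rewrite /labp /labq /GRing.scale/=; ring.
Qed.

Lemma is_derive_labp (v1 v2 t : R) : is_derive t 1 (labp v1 v2) (- labq v1 v2 t).
Proof.
apply: is_derive_eq
  (is_derive_labp_comp (is_derive_cst v1 t 1) (is_derive_cst v2 t 1)) _.
by rewrite /labp /labq /=; ring.
Qed.

Lemma is_derive_labq (v1 v2 t : R) : is_derive t 1 (labq v1 v2) (labp v1 v2 t).
Proof.
apply: is_derive_eq
  (is_derive_labq_comp (is_derive_cst v1 t 1) (is_derive_cst v2 t 1)) _.
by rewrite /labp /labq /=; ring.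
Qed.

Lemma is_derive_continuous (f : R -> R) (t l : R) :
  is_derive t 1 f l -> {for t, continuous f}.
Proof. by move=> [df _]; exact/differentiable_continuous/derivable1_diffP. Qed.

(** The modulus of the momentum coordinate is maximal where the position coordinate
    vanishes, which happens in every half-turn; it stays above half its maximum for
    half a radian because the slope never exceeds that maximum. *)
Lemma labp_peak (v1 v2 : R) : exists2 t, 0 <= t <= pi &
  forall s, 0 <= s - t <= 1 / 2 ->
  Num.sqrt (v1 ^+ 2 + v2 ^+ 2) / 2 <= `|labp v1 v2 s|.
Proof.
set nu := Num.sqrt _.
have nu0 : 0 <= nu by exact: sqrtr_ge0.
have nu2 : nu ^+ 2 = v1 ^+ 2 + v2 ^+ 2.
  by rewrite sqr_sqrtr// addr_ge0 ?sqr_ge0.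
have lqnu t : `|labq v1 v2 t| <= nu.
  rewrite -(@ler_pXn2r _ 2)// ?nnegrE// real_normK ?num_real// nu2.
  by rewrite -(lab_norm v1 v2 t) lerDl sqr_ge0.
have [t tpi qt0] : exists2 t, t \in `[0, pi]%R & labq v1 v2 t = 0.
  apply: IVT; first exact: pi_ge0.
    apply: continuous_subspaceT => x.
    exact: is_derive_continuous (is_derive_labq _ _ _).
  rewrite /labq cos0 sin0 cospi sinpi; case: (leP 0 v1) => v10.
    by rewrite ge_min le_max; apply/andP; split; apply/orP; [right|left]; lra.
  by rewrite ge_min le_max; apply/andP; split; apply/orP; [left|right]; lra.
exists t; first by move: tpi; rewrite in_itv.
move=> s /andP[ts st].
have pt : `|labp v1 v2 t| = nu.
  apply/eqP; rewrite -(@eqrXn2 _ 2)// real_normK ?num_real// nu2.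
  by rewrite -(lab_norm v1 v2 t) qt0 expr0n add0r.
have ts' : t <= s by lra.
have := mean_value_norm ts' (fun x _ => is_derive_labp v1 v2 x) (B := nu).
move=> /(_ _)/wrap[x _|]; first by rewrite normrN.
have := ler_dist_dist (labp v1 v2 s) (labp v1 v2 t); rewrite pt.
rewrite ler_norml => /andP[+ _].
have : nu * (s - t) <= nu * (1 / 2) by rewrite ler_wpM2l.
lra.
Qed.

Lemma twopi_le8 : pi *+ 2 <= 8 :> R.
Proof. by have := @pihalf_lt2 R; rewrite ltr_pdivrMr// mulr2n; lra. Qed.

(** With A = labp v1 v2 and B = labq v1 v2 one has A' = - B, and
    |v|^2 (- sin, cos) = A v + B (- v2, v1).  Hence |v|^2 (- sin, cos) g(A) is
    v times A g(A), whose primitive H is nondecreasing, plus (- v2, v1) times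
    B g(A), which is minus the derivative of the periodic function G o A, where
    G is a primitive of g.  Only the component along v survives a full turn.  The
    lower bound for kappa is the growth of H on the interval of [labp_peak], where
    A g(A) is at least alpha (eta / 2) times |v| / 2. *)
Lemma frozen_average (g : R -> R) (v1 v2 L r : R) :
  continuous g -> (forall s, 0 <= s * g s) -> 0 < r -> 0 <= L ->
  (forall s, `|s| <= r -> `|g s| <= L * `|s|) -> v1 ^+ 2 + v2 ^+ 2 <= r ^+ 2 ->
  exists kappa Fa Fb,
  [/\ 0 <= kappa <= 8 * L,
      forall alpha, class_K alpha -> (forall s, alpha `|s| <= `|g s|) ->
        forall eta, 0 < eta -> eta ^+ 2 <= v1 ^+ 2 + v2 ^+ 2 ->
        alpha (eta / 2) / (4 * r) <= kappa,
      forall t : R, 0 <= t ->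
        is_derive t 1 Fa (- (sin t * g (labp v1 v2 t))) /\
        is_derive t 1 Fb (cos t * g (labp v1 v2 t)),
      Fa (pi *+ 2) - Fa 0 = kappa * v1 &
      Fb (pi *+ 2) - Fb 0 = kappa * v2].
Proof.
move=> cg g0 r0 L0 gL vr.
have g00 : g 0 = 0.
  by have := gL 0; rewrite normr0 mulr0 normr_le0 ltW// => /(_ isT)/eqP.
set nu := v1 ^+ 2 + v2 ^+ 2.
have nu0 : 0 <= nu by rewrite addr_ge0 ?sqr_ge0.
have [nuz|nun] := eqVneq nu 0.
  have [v10 v20] : v1 = 0 /\ v2 = 0.
    by move/eqP: nuz; rewrite paddr_eq0 ?sqr_ge0// !sqrf_eq0 => /andP[/eqP-> /eqP->].
  exists 0, (cst 0), (cst 0); split.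
  - by rewrite lexx mulr_ge0.
  - move=> alpha _ _ eta eta0.
    by rewrite nuz leNgt exprn_gt0.
  - move=> t _; rewrite /labp v10 v20 !mulr0 subrr g00 !mulr0 oppr0.
    by split; exact: is_derive_cst.
  - by rewrite v10 mulr0 subrr.
  - by rewrite v20 mulr0 subrr.
have nup : 0 < nu by rewrite lt_neqAle eq_sym nun.
pose A := labp v1 v2; pose B := labq v1 v2.
have A2 t : A t ^+ 2 <= nu by rewrite /nu -(lab_norm v1 v2 t) lerDr sqr_ge0.
have Ar t : `|A t| <= r.
  rewrite -(@ler_pXn2r _ 2)// ?nnegrE ?(ltW r0)// real_normK ?num_real//.
  exact: le_trans (A2 t) vr.
have cA : continuous A.
  by move=> x; exact: is_derive_continuous (is_derive_labp _ _ _).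
have [G HG] := antiderivative (- r - 1) cg.
have dGA (t : R) : is_derive t 1 (G \o A) (g (A t) * - B t).
  have dG : is_derive (A t) 1 G (g (A t)).
    by apply: HG; have := Ar t; rewrite ler_norml => /andP[+ _]; lra.
  exact: is_derive1_comp dG (is_derive_labp v1 v2 t).
have [|H HH] := @antiderivative R (fun t => A t * g (A t)) (-1).
  by move=> x; apply: cvgM; [exact: cA|apply: continuous_comp; [exact: cA|exact: cg]].
have HH' (t : R) : 0 <= t -> is_derive t 1 H (A t * g (A t)).
  by move=> t0; apply: HH; lra.
have Hincr s t : 0 <= s -> s <= t -> H s <= H t.
  move=> s0 st; have [x /andP[sx _]|c _ E] := mean_value st (f := H) (df := fun t => A t * g (A t)).
    by apply: HH'; exact: le_trans sx.
  by rewrite -subr_ge0 E mulr_ge0// subr_ge0.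
have pi2 : 0 <= pi *+ 2 :> R by rewrite mulrn_wge0// pi_ge0.
pose Fa := nu^-1 \*: ((v1 \*: H) + (v2 \*: (G \o A))).
pose Fb := nu^-1 \*: ((v2 \*: H) - (v1 \*: (G \o A))).
have per : A (pi *+ 2) = A 0 by rewrite /A /labp cos2pi sin2pi cos0 sin0.
exists ((H (pi *+ 2) - H 0) / nu), Fa, Fb; split.
- apply/andP; split; first by rewrite divr_ge0// subr_ge0 Hincr.
  rewrite ler_pdivrMr//.
  have [x /andP[sx _]|c cpi ->] := mean_value pi2 (f := H) (df := fun t => A t * g (A t)).
    exact: HH'.
  rewrite subr0.
  have Agle : A c * g (A c) <= L * nu.
    apply: (le_trans (ler_norm _)); rewrite normrM.
    apply: (@le_trans _ _ (`|A c| * (L * `|A c|))); first by rewrite ler_wpM2l// gL.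
    by rewrite mulrCA ler_wpM2l// -expr2 real_normK ?num_real.
  have : (A c * g (A c)) * (pi *+ 2) <= L * nu * 8.
    by apply: ler_pM => //; exact: twopi_le8.
  lra.
- move=> alpha [a1 a2 a0 aincr] ag eta eta0 etanu.
  have [t /andP[t0 tpi] peak] := labp_peak v1 v2.
  set s := Num.sqrt _ in peak.
  have s2 : s * s = nu by rewrite -expr2 sqr_sqrtr.
  have s0 : 0 < s by rewrite sqrtr_gt0.
  have etas : eta <= s.
    by rewrite -(ger0_norm (ltW eta0)) -sqrtr_sqr ler_sqrt.
  have sr : s <= r by rewrite -(ger0_norm (ltW r0)) -sqrtr_sqr ler_sqrt// sqr_ge0.
  have aeta0 : 0 < alpha (eta / 2) by rewrite -a0; apply: aincr; rewrite ?divr_gt0.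
  have th : t <= t + 1 / 2 by rewrite lerDl divr_ge0.
  have [x /andP[tx _]|x /andP[tx xt] E] :=
      mean_value th (f := H) (df := fun t => A t * g (A t)).
    by apply: HH'; exact: le_trans tx.
  have sA : s / 2 <= `|A x| by apply: peak; apply/andP; split; lra.
  have gA : s / 2 * alpha (eta / 2) <= A x * g (A x).
    rewrite -(ger0_norm (g0 (A x))) normrM; apply: ler_pM => //.
    - by rewrite divr_ge0// ltW.
    - exact: ltW.
    - apply: le_trans (ag _).
      have : eta / 2 <= `|A x| by lra.
      rewrite le_eqVlt => /predU1P[->//|etaA].
      by apply/ltW/aincr => //; rewrite divr_ge0// ltW.
  have H1 : H 0 <= H t by exact: Hincr.
  have H2 : H (t + 1 / 2) <= H (pi *+ 2).
    by apply: Hincr; have := @pi_ge2 R; lra.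
  rewrite ler_pdivlMr//.
  have -> : alpha (eta / 2) / (4 * r) * nu = (s / 2 * alpha (eta / 2)) / 2 * (s / r).
    by rewrite -s2; field; rewrite gt_eqF.
  apply: (@le_trans _ _ ((s / 2 * alpha (eta / 2)) / 2)).
    rewrite ler_piMr ?ler_pdivrMr// ?mul1r//.
    by rewrite !(divr_ge0, mulr_ge0)// ltW.
  lra.
- move=> t t0; have := HH' t t0 => ?; have := dGA t => ?; split.
  + apply: is_derive_eq; rewrite /GRing.scale/=.
    rewrite (_ : _ + _ = nu * - (sin t * g (A t))) ?mulKf//.
    by rewrite /A /B /labp /labq /nu; ring.
  + apply: is_derive_eq; rewrite /GRing.scale/=.
    rewrite (_ : _ - _ = nu * (cos t * g (A t))) ?mulKf//.
    by rewrite /A /B /labp /labq /nu; ring.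
- rewrite /Fa !fctE /= per /GRing.scale/=.
  by rewrite mulrAC -mulrBr mulrC; congr (_ * _); ring.
- rewrite /Fb !fctE /= per /GRing.scale/=.
  by rewrite mulrAC -mulrBr mulrC; congr (_ * _); ring.
Qed.

End RotatingFrame.

(** * One period of the array in the rotating frame *)

Section UnitVectors.
Context (R : realType).

Lemma dot_unit_sq (u1 u2 v1 v2 : R) : u1 ^+ 2 + u2 ^+ 2 = 1 ->
  (u1 * v1 + u2 * v2) ^+ 2 <= v1 ^+ 2 + v2 ^+ 2.
Proof.
move=> u1E; rewrite -[leRHS]mul1r -u1E -subr_ge0.
rewrite (_ : _ - _ = (u1 * v2 - u2 * v1) ^+ 2); last by ring.
exact: sqr_ge0.
Qed.

Lemma dot_unit_le (u1 u2 v1 v2 m : R) : u1 ^+ 2 + u2 ^+ 2 = 1 -> 0 <= m ->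
  v1 ^+ 2 + v2 ^+ 2 <= m ^+ 2 -> `|u1 * v1 + u2 * v2| <= m.
Proof.
move=> u1E m0 vm; rewrite -(@ler_pXn2r _ 2)// ?nnegrE// real_normK ?num_real//.
by apply: le_trans vm; exact: dot_unit_sq.
Qed.

Lemma norm_le_dot (v1 v2 D : R) :
  (forall u1 u2, u1 ^+ 2 + u2 ^+ 2 = 1 -> u1 * v1 + u2 * v2 <= D) ->
  Num.sqrt (v1 ^+ 2 + v2 ^+ 2) <= D.
Proof.
move=> vD; set nu := Num.sqrt _.
have nu2 : nu ^+ 2 = v1 ^+ 2 + v2 ^+ 2.
  by rewrite sqr_sqrtr// addr_ge0 ?sqr_ge0.
have [nu0|nu0] := eqVneq nu 0.
  have := vD 1 0; have := vD (-1) 0; rewrite nu0 sqrrN expr1n expr0n addr0.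
  by move=> /(_ erefl) ? /(_ erefl); lra.
have := vD (v1 / nu) (v2 / nu).
have -> : v1 / nu * v1 + v2 / nu * v2 = nu.
  by apply: (mulIf nu0); rewrite -expr2 nu2; field.
apply; rewrite !expr_div_n -mulrDl -nu2 divff// expf_neq0//.
Qed.

Lemma lab_unit (t : R) : (- sin t) ^+ 2 + cos t ^+ 2 = 1.
Proof. by rewrite sqrrN addrC cos2Dsin2. Qed.

Lemma labpE (v1 v2 t : R) : labp v1 v2 t = - sin t * v1 + cos t * v2.
Proof. by rewrite /labp; ring. Qed.

Lemma labp_unit_le (u1 u2 t : R) : u1 ^+ 2 + u2 ^+ 2 = 1 -> `|labp u1 u2 t| <= 1.
Proof.
by move=> u1E; rewrite labpE; apply: dot_unit_le; rewrite ?lab_unit ?u1E ?expr1n.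
Qed.

Lemma is_derive_sum_cond n (P : pred 'I_n) (f : 'I_n -> R -> R) (df : 'I_n -> R)
    (x : R) : (forall j, P j -> is_derive x 1 (f j) (df j)) ->
  is_derive x 1 (fun t => \sum_(j < n | P j) f j t) (\sum_(j < n | P j) df j).
Proof.
move=> fdf; rewrite (_ : (fun _ => _) = \sum_(j < n | P j) f j); last first.
  by apply/funext => t; rewrite fct_sumE.
elim/big_ind2 : _ => [|f1 d1 f2 d2 ? ?|j Pj]; [exact: is_derive_cst| |exact: fdf].
exact: is_deriveD.
Qed.

End UnitVectors.

Section SlowSystem.
Context (R : realType) (n : nat) (gamma : 'I_n -> 'I_n -> R -> R).

Definition coupling (a b : 'I_n -> R -> R) (i : 'I_n) (t : R) : R :=
  \sum_(j < n | j != i) gamma i j (labp (a j t - a i t) (b j t - b i t) t).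

Definition slow_solution (h : R) (a b : 'I_n -> R -> R) : Prop :=
  forall (i : 'I_n) (t : R), 0 <= t ->
    is_derive t 1 (a i) (- (sin t * (h * coupling a b i t))) /\
    is_derive t 1 (b i) (cos t * (h * coupling a b i t)).

(** For D >= 0 this says that the planar points (a i, b i) have diameter at most
    D; the quantification over directions reduces planar estimates to scalar
    ones, and is invariant under rotations. *)
Definition spread_le (a b : 'I_n -> R) (D : R) : Prop :=
  forall i j u1 u2, u1 ^+ 2 + u2 ^+ 2 = 1 ->
    u1 * (a i - a j) + u2 * (b i - b j) <= D.

Lemma spread_le_norm (a b : 'I_n -> R) D i j (u1 u2 : R) : spread_le a b D ->
  u1 ^+ 2 + u2 ^+ 2 = 1 -> `|u1 * (a i - a j) + u2 * (b i - b j)| <= D.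
Proof.
move=> ab uE; rewrite ler_norml ab// andbT.
by have := ab j i _ _ uE; lra.
Qed.

Lemma slow_solution_dot h a b i (u1 u2 t : R) : slow_solution h a b -> 0 <= t ->
  is_derive t 1 (fun t => u1 * a i t + u2 * b i t)
    (labp u1 u2 t * (h * coupling a b i t)).
Proof.
move=> ab t0; have [? ?] := ab i t t0.
rewrite (_ : (fun _ => _) = (u1 \*: a i) + (u2 \*: b i))//.
by apply: is_derive_eq; rewrite /labp /GRing.scale/=; ring.
Qed.

Context (L r : R) (alpha : 'I_n -> 'I_n -> R -> R).
Hypotheses (L0 : 0 < L) (r0 : 0 < r).
Hypothesis gamma_cont : forall i j, i != j -> continuous (gamma i j).
Hypothesis gamma_sign : forall i j, i != j -> forall s, 0 <= s * gamma i j s.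
Hypothesis gamma_0 : forall i j, i != j -> gamma i j 0 = 0.
Hypothesis gamma_lip : forall i j, i != j -> forall y z, `|y| <= r -> `|z| <= r ->
  `|gamma i j y - gamma i j z| <= L * `|y - z|.
Hypothesis gamma_alpha : forall i j, edge gamma i j ->
  class_K (alpha i j) /\ forall s, alpha i j `|s| <= `|gamma i j s|.

Let gamma_lin i j (s : R) : i != j -> `|s| <= r -> `|gamma i j s| <= L * `|s|.
Proof.
move=> ij sr; have := @gamma_lip i j ij s 0 sr.
by rewrite gamma_0// !subr0 normr0; apply; exact: ltW.
Qed.

(** Duration 2 pi <= 8 times the speed bound: each oscillator is influenced by at
    most [n] couplings, each at most [L * r] on the region of radius [r]. *)
Definition drift (h : R) : R := 8 * (h * (n%:R * (L * r))).

(** Error made by freezing the differences x_j - x_i over a period: each moves by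
    at most twice the drift. *)
Definition period_error (h : R) : R := 8 * (h * (n%:R * (L * (drift h *+ 2)))).

Section Period.
Context (h D : R) (a b : 'I_n -> R -> R).
Hypotheses (h0 : 0 < h) (Dr : D + 2 <= r).
Hypothesis hW : n%:R * (drift h ^+ 2 *+ 2) < 1.
Hypothesis ab : slow_solution h a b.
Hypothesis spread0 : spread_le (a ^~ 0) (b ^~ 0) D.

(** The bounds on the couplings hold only while the configuration stays in the
    region of radius [r].  The total squared displacement [Q] cannot leave
    [0, 1] within a period: as long as it stays there the speeds are bounded, and
    these bounds keep it strictly below 1. *)
Let Q (t : R) : R := \sum_(i < n) ((a i t - a i 0) ^+ 2 + (b i t - b i 0) ^+ 2).

Let Q_dot i (t u1 u2 : R) : Q t <= 1 -> u1 ^+ 2 + u2 ^+ 2 = 1 ->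
  `|u1 * (a i t - a i 0) + u2 * (b i t - b i 0)| <= 1.
Proof.
move=> Qt uE; apply: dot_unit_le => //; rewrite expr1n; apply: le_trans Qt.
by rewrite /Q (bigD1 i)//= lerDl sumr_ge0// => j _; rewrite addr_ge0 ?sqr_ge0.
Qed.

Let coupling_le i t : Q t <= 1 -> `|coupling a b i t| <= n%:R * (L * r).
Proof.
move=> Qt; apply: le_trans (ler_norm_sum _ _ _) _.
apply: (@le_trans _ _ (\sum_(j < n) L * r)); last first.
  by rewrite sumr_const card_ord mulr_natl.
rewrite big_mkcond/=; apply: ler_sum => j _; case: ifPn => ji; last first.
  by rewrite mulr_ge0 ?ltW.
have pr : `|labp (a j t - a i t) (b j t - b i t) t| <= r.
  apply: le_trans Dr.
  rewrite labpE.
  have := spread_le_norm j i spread0 (lab_unit t).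
  have := Q_dot i Qt (lab_unit t); have := Q_dot j Qt (lab_unit t).
  rewrite !ler_norml; move: (sin t) (cos t) => s c.
  by move=> /andP[? ?] /andP[? ?] /andP[? ?]; apply/andP; split; lra.
rewrite eq_sym in ji; apply: le_trans (gamma_lin ji pr) _.
by rewrite ler_wpM2l// ltW.
Qed.

Let displacement_le i (t u1 u2 : R) : 0 <= t ->
  (forall s, 0 <= s <= t -> Q s <= 1) -> u1 ^+ 2 + u2 ^+ 2 = 1 ->
  `|u1 * (a i t - a i 0) + u2 * (b i t - b i 0)| <= h * (n%:R * (L * r)) * t.
Proof.
move=> t0 Q1 uE.
have := @mean_value_norm R (fun t => u1 * a i t + u2 * b i t)
  (fun t => labp u1 u2 t * (h * coupling a b i t)) 0 t
  (h * (n%:R * (L * r))) t0.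
rewrite subr0 (_ : _ - _ = u1 * (a i t - a i 0) + u2 * (b i t - b i 0)); last by ring.
apply=> s /[dup] sst /andP[s0 _]; first exact: slow_solution_dot.
rewrite normrM -[leRHS]mul1r; apply: ler_pM => //; first exact: labp_unit_le.
by rewrite normrM gtr0_norm// ler_wpM2l ?(ltW h0)//; apply: coupling_le; exact: Q1.
Qed.

Let Q_le1 (t : R) : 0 <= t <= pi *+ 2 -> Q t <= 1.
Proof.
have W0 : 0 <= drift h by rewrite !mulr_ge0// ltW.
have cQ (w : R) : 0 <= w -> {for w, continuous Q}.
  move=> w0; apply: (@is_derive_continuous _ _ _ (\sum_(i < n) _)).
  rewrite (_ : Q = fun t => \sum_(i < n | xpredT i)
    (((a i - cst (a i 0)) ^+ 2) + ((b i - cst (b i 0)) ^+ 2)) t); last first.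
    by apply/funext => s; apply: eq_bigr => i _; rewrite !fctE.
  apply: is_derive_sum_cond => i _; have [? ?] := ab i w0.
  exact: is_deriveD.
have Q1 (w : R) : 0 <= w <= pi *+ 2 -> (forall s, 0 <= s <= w -> Q s <= 1) -> Q w < 1.
  move=> /andP[w0 w2] Qs; apply: le_lt_trans hW.
  rewrite mulr_natl -[X in _ *+ X]card_ord -sumr_const.
  have disp i (u1 u2 : R) : u1 ^+ 2 + u2 ^+ 2 = 1 ->
      (u1 * (a i w - a i 0) + u2 * (b i w - b i 0)) ^+ 2 <= drift h ^+ 2.
    move=> uE; rewrite -real_normK ?num_real// ler_pXn2r ?nnegrE//.
    apply: le_trans (@displacement_le i _ _ _ w0 Qs uE) _.
    rewrite /drift mulrC; apply: ler_wpM2r; first by rewrite !mulr_ge0// ltW.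
    exact: (le_trans w2 (twopi_le8 R)).
  apply: ler_sum => i _; rewrite mulr2n; apply: lerD.
    by have := disp i 1 0; rewrite !mul1r mul0r addr0; apply; ring.
  by have := disp i 0 1; rewrite !mul1r mul0r add0r; apply; ring.
move=> /andP[t0 t2].
suff : forall s, 0 <= s <= t -> Q s <= 1 by apply; rewrite t0 lexx.
apply: (@locally_constant_segment _
  (fun t => forall s, 0 <= s <= t -> Q s <= 1) 0 t) => //; last first.
  move=> s; rewrite -eq_le => /eqP <-.
  by rewrite /Q big1 ?ler01// => i _; rewrite !subrr expr0n addr0.
move=> x /andP[x0 xt].
have [Px|/existsNP[s]] := pselect (forall s, 0 <= s <= x -> Q s <= 1).
  have := cQ x x0; have := Q1 x; rewrite x0 (le_trans xt)// => /(_ isT Px) Qx.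
  move=> /cvgrPdist_lt/(_ (1 - Q x)); rewrite subr_gt0 => /(_ Qx)[d/= d0 Hd].
  exists d => // y z /andP[y0 yt] /andP[z0 zt] xy xz Py s /andP[s0 sz].
  have [sx|xs] := leP s x; first by apply: Px; rewrite s0.
  have := Hd s; rewrite /ball_/=.
  have xsd : `|x - s| < d.
    by move: xz; rewrite !ltr_distl => /andP[? ?]; apply/andP; split; lra.
  by move=> /(_ xsd); rewrite ltr_distl => /andP[]; lra.
move=> /not_implyP[/andP[s0 sx] /negP]; rewrite -ltNge => Qs.
have [xE|sx'] := eqVneq s x.
  have := cQ x x0; rewrite xE in Qs.
  move=> /cvgrPdist_lt/(_ (Q x - 1)); rewrite subr_gt0 => /(_ Qs)[d/= d0 Hd].
  exists d => // y z /andP[y0 yt] _ xy _ /(_ y); rewrite y0 lexx => /(_ isT).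
  by have := Hd y xy; rewrite ltr_distl => /andP[]; lra.
have {}sx : s < x by rewrite lt_neqAle sx'.
exists (x - s); first by rewrite subr_gt0.
move=> y z _ _ xy _ Py; exfalso.
have sy : s <= y by move: xy; rewrite ltr_distl => /andP[? ?]; apply/ltW; lra.
by have := Py s; rewrite s0 sy => /(_ isT); rewrite leNgt Qs.
Qed.

Lemma period_displacement i (t u1 u2 : R) : 0 <= t <= pi *+ 2 ->
  u1 ^+ 2 + u2 ^+ 2 = 1 ->
  `|u1 * (a i t - a i 0) + u2 * (b i t - b i 0)| <= drift h.
Proof.
move=> /andP[t0 t2] uE.
apply: le_trans (@displacement_le i _ _ _ t0 _ uE) _.
  by move=> s /andP[s0 st]; apply: Q_le1; rewrite s0 (le_trans st).
rewrite /drift mulrC; apply: ler_wpM2r; first by rewrite !mulr_ge0// ltW.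
exact: (le_trans t2 (twopi_le8 R)).
Qed.

Lemma period_spread (t : R) : 0 <= t <= pi *+ 2 ->
  spread_le (a ^~ t) (b ^~ t) (D + drift h *+ 2).
Proof.
move=> t02 i j u1 u2 uE.
have := period_displacement i t02 uE; have := period_displacement j t02 uE.
have := spread0 i j uE.
rewrite !ler_norml => ? /andP[? ?] /andP[? ?]; lra.
Qed.

(** Comparing the true trajectory with the explicit primitives provided by
    [frozen_average]: the difference of the derivatives is small by the
    Lipschitz condition. *)
Lemma period_step (u1 u2 : R) : u1 ^+ 2 + u2 ^+ 2 = 1 ->
  consensus_step h (8 * L) (period_error h) (edge gamma)
    (fun i j eta => alpha i j (eta / 2) / (4 * r))
    (fun i => u1 * a i 0 + u2 * b i 0)
    (fun i => u1 * a i (pi *+ 2) + u2 * b i (pi *+ 2)).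
Proof.
move=> uE i.
have W0 : 0 <= drift h by rewrite !mulr_ge0// ltW.
pose v1 j := a j 0 - a i 0; pose v2 j := b j 0 - b i 0.
have vr j : v1 j ^+ 2 + v2 j ^+ 2 <= r ^+ 2.
  have v0 : 0 <= v1 j ^+ 2 + v2 j ^+ 2 by rewrite addr_ge0 ?sqr_ge0.
  rewrite -(sqr_sqrtr v0) ler_pXn2r ?nnegrE ?sqrtr_ge0 ?(ltW r0)//.
  have Dr' : D <= r by have := Dr; lra.
  apply: le_trans Dr'.
  by apply: norm_le_dot => w1 w2; exact: spread0.
have /choice[f Hf] j : exists kF : R * (R -> R) * (R -> R), j != i ->
  [/\ 0 <= kF.1.1 <= 8 * L,
      forall alpha, class_K alpha ->
        (forall s, alpha `|s| <= `|gamma i j s|) ->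
        forall eta, 0 < eta -> eta ^+ 2 <= v1 j ^+ 2 + v2 j ^+ 2 ->
        alpha (eta / 2) / (4 * r) <= kF.1.1,
      forall t : R, 0 <= t ->
        is_derive t 1 kF.1.2 (- (sin t * gamma i j (labp (v1 j) (v2 j) t))) /\
        is_derive t 1 kF.2 (cos t * gamma i j (labp (v1 j) (v2 j) t)),
      kF.1.2 (pi *+ 2) - kF.1.2 0 = kF.1.1 * v1 j &
      kF.2 (pi *+ 2) - kF.2 0 = kF.1.1 * v2 j].
  have [->|ji] := eqVneq j i; first by exists (0, cst 0, cst 0).
  have ij : i != j by rewrite eq_sym.
  have [k [Fa [Fb H]]] := @frozen_average R (gamma i j) (v1 j) (v2 j) L r
    (gamma_cont ij) (gamma_sign ij) r0 (ltW L0) (fun s => gamma_lin ij) (vr j).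
  by exists (k, Fa, Fb).
exists (fun j => (f j).1.1); split.
- by move=> j /Hf[].
- move=> j eta eij eta0 etay; have ij : i != j by case/andP: eij.
  have ji : j != i by rewrite eq_sym.
  have [aK ag] := gamma_alpha eij.
  have [_ fK _ _ _] := Hf j ji; apply: fK => //.
  apply: le_trans (dot_unit_sq (v1 j) (v2 j) uE).
  rewrite -[leRHS]real_normK ?num_real// ler_pXn2r ?nnegrE ?(ltW eta0)//.
  by apply: le_trans etay _; rewrite /v1 /v2 le_eqVlt; apply/orP; left;
    apply/eqP; congr (`|_|); ring.
(* [G] is the part of the displacement that freezing does not explain. *)
pose G t := (u1 * a i t + u2 * b i t)
  - h * \sum_(j < n | j != i) (u1 * (f j).1.2 t + u2 * (f j).2 t).
pose dG t := labp u1 u2 t * (h * coupling a b i t)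
  - h * \sum_(j < n | j != i) labp u1 u2 t * gamma i j (labp (v1 j) (v2 j) t).
have pi20 : 0 <= pi *+ 2 :> R by rewrite mulrn_wge0// pi_ge0.
have dGP (t : R) : 0 <= t <= pi *+ 2 -> is_derive t 1 G (dG t).
  move=> /andP[t0 _].
  have d1 := slow_solution_dot i u1 u2 ab t0.
  have d2 : is_derive t 1
      (fun t => \sum_(j < n | j != i) (u1 * (f j).1.2 t + u2 * (f j).2 t))
      (\sum_(j < n | j != i) labp u1 u2 t * gamma i j (labp (v1 j) (v2 j) t)).
    apply: is_derive_sum_cond => l li; have [_ _ /(_ t t0)[? ?] _ _] := Hf l li.
    rewrite (_ : (fun _ => _) = (u1 \*: (f l).1.2) + (u2 \*: (f l).2))//.
    by apply: is_derive_eq; rewrite {3}/labp /GRing.scale/=; ring.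
  exact: is_deriveB d1 (is_deriveZ h d2).
have dGle t : 0 <= t <= pi *+ 2 ->
    `|dG t| <= h * (n%:R * (L * (drift h *+ 2))).
  move=> t02; rewrite /dG -mulr_sumr mulrCA -mulrBr -mulrBr.
  rewrite normrM gtr0_norm// ler_pM2l// normrM -[leRHS]mul1r.
  apply: ler_pM => //; first exact: labp_unit_le.
  rewrite /coupling -sumrB; apply: le_trans (ler_norm_sum _ _ _) _.
  apply: (@le_trans _ _ (\sum_(j < n) L * (drift h *+ 2))); last first.
    by rewrite sumr_const card_ord mulr_natl.
  rewrite big_mkcond/=; apply: ler_sum => j _; case: ifPn => ji; last first.
    by rewrite mulr_ge0 ?(ltW L0)// mulrn_wge0.
  have ij : i != j by rewrite eq_sym.
  have Wr : D + drift h *+ 2 <= r.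
    apply: le_trans Dr; rewrite lerD2l.
    have n1 : 1 <= n%:R :> R by rewrite ler1n (leq_ltn_trans _ (ltn_ord i)).
    have W2 : drift h ^+ 2 <= 1.
      have W20 : 0 <= drift h ^+ 2 *+ 2 by rewrite mulrn_wge0// sqr_ge0.
      by have := ler_wpM2r W20 n1; have := hW; rewrite mul1r; lra.
    by have : drift h <= 1; [rewrite -(@ler_pXn2r _ 2)// ?nnegrE// expr1n|lra].
  apply: le_trans (gamma_lip ij _ _) _.
  - rewrite labpE; apply: le_trans Wr.
    exact: spread_le_norm (period_spread t02) (lab_unit t).
  - rewrite labpE; have Dr' : D <= r by have := Dr; lra.
    apply: le_trans Dr'.
    exact: spread_le_norm spread0 (lab_unit t).
  - rewrite ler_wpM2l ?(ltW L0)// !labpE.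
    have := period_displacement i t02 (lab_unit t).
    have := period_displacement j t02 (lab_unit t).
    rewrite !ler_norml /v1 /v2; move: (sin t) (cos t) => s c.
    by move=> /andP[? ?] /andP[? ?]; apply/andP; split; lra.
have := mean_value_norm pi20 dGP dGle.
rewrite subr0 (_ : G (pi *+ 2) - G 0 = u1 * a i (pi *+ 2) + u2 * b i (pi *+ 2) -
  (u1 * a i 0 + u2 * b i 0 + h * \sum_(j < n | j != i)
     (f j).1.1 * (u1 * a j 0 + u2 * b j 0 - (u1 * a i 0 + u2 * b i 0)))).
  move=> /le_trans; apply; rewrite mulrC /period_error; apply: ler_wpM2r.
    by rewrite !mulr_ge0 ?(ltW h0) ?(ltW L0)// mulrn_wge0.
  exact: twopi_le8.
rewrite /G (_ : \sum_(j < n | j != i) (f j).1.1 * _ =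
  \sum_(j < n | j != i) (u1 * (f j).1.2 (pi *+ 2) + u2 * (f j).2 (pi *+ 2)) -
  \sum_(j < n | j != i) (u1 * (f j).1.2 0 + u2 * (f j).2 0)); first by ring.
rewrite -sumrB; apply: eq_bigr => j /Hf[_ _ _ Ea Eb].
rewrite (_ : _ - _ = u1 * v1 j + u2 * v2 j); last by rewrite /v1 /v2; ring.
rewrite mulrDr mulrCA -Ea mulrCA -Eb; ring.
Qed.

End Period.

(** * Contraction over blocks of periods *)

Definition shift_periods (k : nat) (f : 'I_n -> R -> R) (i : 'I_n) (t : R) : R :=
  f i (t + (pi *+ 2) *+ k).

Lemma slow_solution_shift h a b k : slow_solution h a b ->
  slow_solution h (shift_periods k a) (shift_periods k b).
Proof.
move=> ab i t t0.
have T0 : 0 <= (pi *+ 2) *+ k :> R by rewrite mulrn_wge0// mulrn_wge0// pi_ge0.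
have [da db] := ab i (t + (pi *+ 2) *+ k) (addr_ge0 t0 T0).
have sinE := periodicn (@sinD2pi R) k t; have cosE := periodicn (@cosD2pi R) k t.
have -> : coupling (shift_periods k a) (shift_periods k b) i t =
    coupling a b i (t + (pi *+ 2) *+ k).
  by apply: eq_bigr => j _; rewrite /labp sinE cosE.
rewrite -sinE -cosE.
have ds := @is_derive_shift R t 1 ((pi *+ 2) *+ k).
split; rewrite -[X in is_derive _ _ _ X]mulr1.
- exact: (@is_derive1_comp R (a i) (shift ((pi *+ 2) *+ k)) t _ _ da ds).
- exact: (@is_derive1_comp R (b i) (shift ((pi *+ 2) *+ k)) t _ _ db ds).
Qed.

Context (root : 'I_n).
Hypothesis root_reach : forall i, i != root -> connect (edge gamma) i root.
Hypothesis L1 : 1 <= L.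
Context (Delta : R).
Hypothesis Delta_r : Delta + 3 <= r.

Let n1 : 1 <= n%:R :> R.
Proof. by rewrite ler1n (leq_ltn_trans _ (ltn_ord root)). Qed.

(** The bound at a period is obtained from the initial interval and all the steps
    so far, each of which is a legitimate averaged step because the spread has
    stayed in the region of radius [r]; hence a strong induction. *)
Lemma sample_steps h D a b N : 0 < h -> D <= Delta ->
  n%:R * (drift h ^+ 2 *+ 2) < 1 -> N%:R * period_error h *+ 2 <= 1 ->
  h * N%:R * (n%:R * (8 * L)) <= 1 / 2 ->
  slow_solution h a b -> spread_le (a ^~ 0) (b ^~ 0) D ->
  forall k, (k <= N)%N ->
    spread_le (a ^~ ((pi *+ 2) *+ k)) (b ^~ ((pi *+ 2) *+ k))
      (D + k%:R * period_error h *+ 2).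
Proof.
move=> h0 DD hW hE hN ab sp0.
have E0 : 0 <= period_error h.
  by rewrite /period_error /drift !(mulr_ge0, mulrn_wge0)// ltW.
have K0 : 0 < 8 * L by rewrite mulr_gt0.
suff H k : (k <= N)%N -> forall l, (l <= k)%N ->
    spread_le (a ^~ ((pi *+ 2) *+ l)) (b ^~ ((pi *+ 2) *+ l))
      (D + l%:R * period_error h *+ 2).
  by move=> k kN; exact: (H k kN k).
elim: k => [_ l|k IH kN l lk i j u1 u2 uE].
  by rewrite leqn0 => /eqP ->; rewrite mulr0n mul0r mul0rn addr0.
have {}IH := IH (ltnW kN).
have steps m : (m < k.+1)%N -> consensus_step h (8 * L) (period_error h)
    (edge gamma) (fun i j eta => alpha i j (eta / 2) / (4 * r))
    (fun i => u1 * a i (pi *+ 2 *+ m) + u2 * b i (pi *+ 2 *+ m))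
    (fun i => u1 * a i (pi *+ 2 *+ m.+1) + u2 * b i (pi *+ 2 *+ m.+1)).
  rewrite ltnS => mk.
  have mE : D + m%:R * period_error h *+ 2 + 2 <= r.
    have : m%:R * period_error h <= N%:R * period_error h.
      by rewrite ler_wpM2r// ler_nat (leq_trans mk)// ltnW.
    have := Delta_r; lra.
  have := @period_step h _ (shift_periods m a) (shift_periods m b) h0 mE hW
    (slow_solution_shift m ab) _ u1 u2 uE.
  rewrite /shift_periods add0r -mulrS; apply.
  exact: IH.
have hk : h * k.+1%:R * (n%:R * (8 * L)) <= 1 / 2.
  apply: le_trans hN; rewrite ler_wpM2r ?mulr_ge0 ?(ltW L0)//.
  by rewrite ler_wpM2l ?(ltW h0)// ler_nat.
have := @consensus_spread R n h (8 * L) (period_error h) D _ _ k.+1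
  (fun m i => u1 * a i (pi *+ 2 *+ m) + u2 * b i (pi *+ 2 *+ m)) h0 K0 hk steps.
move=> /(_ _ l i j lk)/wrap[i' j'|].
  by rewrite !mulr0n; have := sp0 i' j' u1 u2 uE; lra.
lra.
Qed.

Lemma pos_threshold (C m : R) : 0 <= C -> 0 < m ->
  exists2 h0, 0 < h0 & forall h, 0 < h -> h <= h0 -> C * h <= m.
Proof.
move=> C0 m0; have C1 : 0 < C + 1 by lra.
exists (m / (C + 1)); first by rewrite divr_gt0.
move=> h h0; rewrite ler_pdivlMr//; lra.
Qed.

Lemma spread_le_trans (a b : 'I_n -> R) (D D' : R) : D <= D' ->
  spread_le a b D -> spread_le a b D'.
Proof. by move=> DD ab i j u1 u2 uE; apply: le_trans DD; exact: ab. Qed.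

(** The number [N] of periods is of order 1 / h, so the errors of order h ^ 2 per
    period add up to order h, while the contraction does not depend on h. *)
Lemma block_contraction (D0 rho : R) : 0 < D0 -> 0 < rho ->
  exists2 beta, 0 < beta & exists2 h0, 0 < h0 & forall h, 0 < h -> h <= h0 ->
  exists2 N, (0 < N)%N & forall a b D, slow_solution h a b ->
    D0 <= D <= Delta -> spread_le (a ^~ 0) (b ^~ 0) D ->
    spread_le (a ^~ ((pi *+ 2) *+ N)) (b ^~ ((pi *+ 2) *+ N)) (D - beta) /\
    forall k t, (k < N)%N -> 0 <= t <= pi *+ 2 ->
      spread_le (a ^~ (t + (pi *+ 2) *+ k)) (b ^~ (t + (pi *+ 2) *+ k)) (D + rho).
Proof.
move=> D00 rho0.
have K0 : 0 < 8 * L by rewrite mulr_gt0.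
(* [S] is the slow time granted to each edge of a path: [n] such spans, each
   overshooting by at most a factor 2, fit in the horizon on which a value loses
   at most half of itself. *)
pose S := (4 * (n%:R * n%:R) * (8 * L))^-1.
have n0 : 0 < n%:R :> R := lt_le_trans ltr01 n1.
have S0 : 0 < S by rewrite invr_gt0 !mulr_gt0.
have c0 i j eta : edge gamma i j -> 0 < eta ->
    0 < alpha i j (eta / 2) / (4 * r).
  move=> /gamma_alpha[[_ _ a0 aincr] _] eta0; rewrite divr_gt0 ?mulr_gt0//.
  by rewrite -a0; apply: aincr => //; rewrite divr_gt0.
have [m m0 Hm] := consensus_contract K0 S0 D00 c0 root_reach.
exists (m / 2); first by rewrite divr_gt0.
pose W := 8 * (n%:R * (L * r)).
have W0 : 0 <= W by rewrite !mulr_ge0 ?(ltW L0) ?(ltW r0).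
have driftE h : drift h = W * h by rewrite /drift /W; ring.
pose C := 8 * (n%:R * L) * W *+ 2.
have C0 : 0 <= C by rewrite mulrn_wge0// mulr_ge0// mulr_ge0// mulr_ge0// ltW.
have errE h : period_error h = C * h * h.
  by rewrite /period_error driftE /C; ring.
have m1 : 0 < Num.min (m / 2) 1 by rewrite lt_min divr_gt0/=.
have [hs1 hs10 Hh1] := pos_threshold C0 m1.
have CW0 : 0 <= C + W * 2 by rewrite addr_ge0// mulr_ge0.
have [hs2 hs20 Hh2] := pos_threshold CW0 rho0.
have n4 : 0 < 1 / (4 * n%:R) :> R by rewrite divr_gt0 ?mulr_gt0.
have [hs3 hs30 Hh3] := pos_threshold W0 n4.
exists (Num.min S (Num.min hs1 (Num.min hs2 hs3))).
  by rewrite !lt_min S0 hs10 hs20 hs30.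
move=> h h0; rewrite !le_min => /and4P[hS /(Hh1 h h0) Ch /(Hh2 h h0) CWh /(Hh3 h h0) Wh].
move: Ch; rewrite le_min => /andP[Chm Ch1].
have [P hP1 hP2] : exists2 P, S <= h * P%:R & h * P%:R <= S *+ 2.
  have Sh : 0 <= S / h by rewrite divr_ge0// ltW.
  have /andP[t1 t2] := truncn_itv Sh.
  exists (Num.truncn (S / h)).+1.
    by rewrite mulrC -ler_pdivrMr// ltW.
  rewrite -natr1 mulrDr mulr1 mulr2n; apply: lerD => //.
  by rewrite mulrC -ler_pdivlMr.
have hN : h * (n * P)%:R * (n%:R * (8 * L)) <= 1 / 2.
  rewrite natrM (_ : _ * _ = h * P%:R * (n%:R * n%:R * (8 * L))); last by ring.
  have q0 : 0 <= n%:R * n%:R * (8 * L) by rewrite !mulr_ge0 ?(ltW L0).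
  apply: le_trans (ler_wpM2r q0 hP2) _.
  rewrite /S le_eqVlt; apply/orP; left; apply/eqP; field.
  by rewrite !gt_eqF.
have P0 : (0 < P)%N.
  by rewrite lt0n; apply: contraTneq hP1 => ->; rewrite mulr0 -ltNge.
exists (n * P)%N; first by rewrite muln_gt0 P0 (leq_ltn_trans _ (ltn_ord root)).
set N := (n * P)%N in hN *.
have hN1 : h * N%:R <= 1 / 2.
  apply: le_trans hN; rewrite ler_peMr ?mulr_ge0 ?(ltW h0)//.
  have : 1 <= n%:R * L by apply: mulr_ege1 => //; exact: n1.
  lra.
have NE : N%:R * period_error h *+ 2 <= C * h.
  rewrite errE (_ : _ *+ 2 = C * h * (h * N%:R) *+ 2); last by ring.
  have : C * h * (h * N%:R) <= C * h * (1 / 2).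
    by rewrite ler_wpM2l// mulr_ge0// ltW.
  lra.
have E0 : 0 <= period_error h by rewrite errE !mulr_ge0// ltW.
have hW : n%:R * (drift h ^+ 2 *+ 2) < 1.
  rewrite driftE.
  have Wh0 : 0 <= W * h by rewrite mulr_ge0// ltW.
  have nW : n%:R * (W * h) <= 1 / 4.
    rewrite mulrC -ler_pdivlMr//.
    by apply: le_trans Wh _; rewrite mul1r mul1r invfM.
  have W1 : W * h <= 1.
    by apply: le_trans (ler_peMl Wh0 n1) _; lra.
  have : n%:R * (W * h) * (W * h) <= 1 / 4 * 1.
    by apply: ler_pM => //; rewrite mulr_ge0.
  have -> : n%:R * ((W * h) ^+ 2 *+ 2) = n%:R * (W * h) * (W * h) *+ 2.
    by ring.
  lra.
move=> a b D ab /andP[D0D DD] sp0.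
have E1 : N%:R * period_error h *+ 2 <= 1 by apply: le_trans NE _.
have samp := sample_steps h0 DD hW E1 hN ab sp0.
have kE k : (k <= N)%N -> k%:R * period_error h <= N%:R * period_error h.
  by move=> kN; rewrite ler_wpM2r// ler_nat.
have Dk k : (k <= N)%N -> D + k%:R * period_error h *+ 2 + 2 <= r.
  by move=> /kE; have := Delta_r; lra.
split.
  move=> i j u1 u2 uE.
  have := Hm h (period_error h) D P
    (fun m i => u1 * a i (pi *+ 2 *+ m) + u2 * b i (pi *+ 2 *+ m)) h0 hP1 hN.
  move=> /(_ _ D0D _ i j)/wrap[k kN|i' j'|].
  - have := @period_step h _ (shift_periods k a) (shift_periods k b) h0 (Dk k (ltnW kN)) hW
      (slow_solution_shift k ab) _ u1 u2 uE.
    rewrite /shift_periods add0r -mulrS; apply.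
    exact: samp (ltnW kN).
  - by rewrite !mulr0n; have := sp0 i' j' u1 u2 uE; lra.
  - by rewrite -/N; lra.
move=> k t kN t02.
have := @period_spread h _ (shift_periods k a) (shift_periods k b) h0 (Dk k (ltnW kN)) hW
      (slow_solution_shift k ab) _ t t02.
rewrite {1 2}/shift_periods add0r => /(_ (samp k (ltnW kN))).
apply: spread_le_trans.
have := kE k (ltnW kN); rewrite driftE; lra.
Qed.

Lemma period_decomposition (t : R) : 0 <= t ->
  exists2 m, (pi *+ 2) *+ m <= t < (pi *+ 2) *+ m.+1 &
  exists2 s, 0 <= s <= pi *+ 2 & t = s + (pi *+ 2) *+ m.
Proof.
move=> t0; have pi0 : 0 < pi *+ 2 :> R by rewrite mulrn_wgt0// pi_gt0.
have /andP[t1 t2] := truncn_itv (divr_ge0 t0 (ltW pi0)).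
set m := Num.truncn _ in t1 t2.
have tm : (pi *+ 2) *+ m <= t < (pi *+ 2) *+ m.+1.
  by rewrite -2!(mulr_natl (pi *+ 2)) -ler_pdivlMr// -ltr_pdivrMr// t1.
exists m => //; exists (t - (pi *+ 2) *+ m); last by rewrite subrK.
by move: tm => /andP[tm1]; rewrite mulrS; lra.
Qed.

(** The bound is restarted at the floor [D0] once the spread falls below it; a
    block that starts at or below [D0] ends there too, so the floor is never left
    at the ends of blocks, and by at most [delta / 2] in between. *)
Lemma slow_practical_stability (delta : R) : 0 < Delta -> 0 < delta ->
  exists2 h0, 0 < h0 & forall h, 0 < h -> h <= h0 ->
  exists D0 T, [/\ 0 < D0, 0 < T & forall a b, slow_solution h a b ->
    [/\ spread_le (a ^~ 0) (b ^~ 0) D0 ->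
          forall t, 0 <= t -> spread_le (a ^~ t) (b ^~ t) delta,
        spread_le (a ^~ 0) (b ^~ 0) Delta ->
          forall t, 0 <= t -> spread_le (a ^~ t) (b ^~ t) (Delta + delta) &
        spread_le (a ^~ 0) (b ^~ 0) Delta ->
          forall t, T <= t -> spread_le (a ^~ t) (b ^~ t) delta]].
Proof.
move=> Delta0 delta0.
pose D0 := Num.min (delta / 2) Delta.
have D00 : 0 < D0 by rewrite lt_min divr_gt0.
have D0delta : D0 <= delta / 2 by rewrite ge_min lexx.
have D0Delta : D0 <= Delta by rewrite ge_min lexx orbT.
have delta20 : 0 < delta / 2 by rewrite divr_gt0.
have [beta beta0 [h0 h00 Hblock]] := block_contraction D00 delta20.
exists h0 => // h hp hh0; have [N N0 {}Hblock] := Hblock h hp hh0.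
pose bound D m := Num.max D0 (D - m%:R * beta).
have bound_le D m : D0 <= D -> bound D m <= D.
  by move=> D0D; rewrite ge_max D0D gerBl mulr_ge0// ltW.
have iter a b D : slow_solution h a b -> D0 <= D <= Delta ->
    spread_le (a ^~ 0) (b ^~ 0) D -> forall m,
    spread_le (a ^~ ((pi *+ 2) *+ (m * N))) (b ^~ ((pi *+ 2) *+ (m * N))) (bound D m).
  move=> ab /andP[D0D DDelta] sp0; elim=> [|m IH].
    by rewrite mul0n mulr0n; apply: spread_le_trans sp0; rewrite le_max mul0r subr0 lexx orbT.
  have bD : D0 <= bound D m <= Delta.
    by rewrite le_max lexx/= (le_trans (bound_le _ _ D0D)).
  have [|H _] := Hblock _ _ _ (slow_solution_shift (m * N) ab) bD.
    by rewrite /shift_periods add0r.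
  move: H; rewrite /shift_periods -mulrnDr addnC mulSn addnC => H.
  apply: spread_le_trans H.
  rewrite lerBlDr ge_max; apply/andP; split.
    by rewrite (le_trans (_ : D0 <= bound D m.+1))// ?lerDl ?(ltW beta0)// le_max lexx.
  apply: (@le_trans _ _ (D - m.+1%:R * beta + beta)).
    by rewrite -natr1; lra.
  by rewrite lerD2r le_max lexx orbT.
have all_times a b D : slow_solution h a b -> D0 <= D <= Delta ->
    spread_le (a ^~ 0) (b ^~ 0) D ->
    forall m t, 0 <= t -> (pi *+ 2) *+ (m * N) <= t ->
    spread_le (a ^~ t) (b ^~ t) (bound D m + delta / 2).
  move=> ab DD sp0 m t t0 mt; have /andP[D0D DDelta] := DD.
  have [k /andP[_ tk] [s s02 tE]] := period_decomposition t0.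
  have pi0 : 0 < pi *+ 2 :> R by rewrite mulrn_wgt0// pi_gt0.
  have mk : (m <= k %/ N)%N.
    rewrite leq_divRL// -ltnS -(ltr_pMn2l pi0).
    exact: le_lt_trans tk.
  have bD : D0 <= bound D (k %/ N)%N <= Delta.
    by rewrite le_max lexx/= (le_trans (bound_le _ _ D0D)).
  have [|_ H] := Hblock _ _ _ (slow_solution_shift (k %/ N * N) ab) bD.
    by rewrite /shift_periods add0r; exact: (iter _ _ _ ab DD sp0).
  have := H (k %% N)%N s (ltn_pmod k N0) s02.
  rewrite /shift_periods -addrA -mulrnDr addnC -divn_eq -tE.
  apply: spread_le_trans; rewrite lerD2r ge_max le_max lexx/= le_max.
  by rewrite lerD2l lerN2 ler_pM2r// ler_nat mk orbT.
have [B B1 HB] : exists2 B, (0 < B)%N & Delta <= B%:R * beta.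
  have /andP[_ tB] := truncn_itv (divr_ge0 (ltW Delta0) (ltW beta0)).
  by exists (Num.truncn (Delta / beta)).+1 => //; rewrite -ler_pdivrMr// ltW.
exists D0, ((pi *+ 2) *+ (B * N)); split => //.
  by rewrite pmulrn_lgt0 ?muln_gt0 ?B1// mulrn_wgt0// pi_gt0.
move=> a b ab; split=> sp0 t t0.
- have DD : D0 <= D0 <= Delta by rewrite lexx.
  have := all_times a b D0 ab DD sp0 0%N t t0; rewrite mul0n mulr0n => /(_ t0).
  by apply: spread_le_trans; have := bound_le D0 0%N (lexx _); lra.
- have DD : D0 <= Delta <= Delta by rewrite lexx D0Delta.
  have := all_times a b Delta ab DD sp0 0%N t t0; rewrite mul0n mulr0n => /(_ t0).
  by apply: spread_le_trans; have := bound_le Delta 0%N D0Delta; lra.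
- have DD : D0 <= Delta <= Delta by rewrite lexx D0Delta.
  have t0' : 0 <= t by apply: le_trans t0; do 2 apply: mulrn_wge0; exact: pi_ge0.
  have := all_times a b Delta ab DD sp0 B t t0' t0.
  apply: spread_le_trans.
  have : bound Delta B <= D0 by rewrite ge_max lexx/=; lra.
  lra.
Qed.

End SlowSystem.

(** * Return to the oscillators *)

Section BackToOscillators.
Context (R : realType) (n : nat) (gamma : 'I_n -> 'I_n -> R -> R).

Lemma enorm_xiB (q p : 'I_n -> R -> R) i j t :
  enorm (xi q p i t - xi q p j t) =
  Num.sqrt ((q i t - q j t) ^+ 2 + (p i t - p j t) ^+ 2).
Proof. by rewrite /enorm big_ord_recl big_ord1 !mxE. Qed.

Lemma rotating_frame (omega : R) (q p : 'I_n -> R -> R) : 0 < omega ->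
  array_solution gamma omega q p ->
  exists a b, slow_solution gamma omega^-1 a b /\
    forall i t, 0 <= t -> q i t = labq (a i (omega * t)) (b i (omega * t)) (omega * t) /\
      p i t = labp (a i (omega * t)) (b i (omega * t)) (omega * t).
Proof.
move=> o0 sol; have on : omega != 0 by rewrite gt_eqF.
have /choice[Q HQ] i : exists F : R -> R, (forall t : R, 0 <= t -> F t = q i t) /\
    forall t : R, 0 <= t -> is_derive t 1 F (omega * p i t).
  have [F F1 F2] := @extend_derive R (q i) (fun t => omega * p i t)
    (fun t t0 => (sol i t t0).1).
  by exists F.
have /choice[P HP] i : exists F : R -> R, (forall t : R, 0 <= t -> F t = p i t) /\
    forall t : R, 0 <= t -> is_derive t 1 F
      (- omega * q i t + \sum_(j < n | j != i) gamma i j (p j t - p i t)).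
  have [F F1 F2] := @extend_derive R (p i) _ (fun t t0 => (sol i t t0).2).
  by exists F.
(* The inverse rotation: exchanging the two coordinates reverses orientation. *)
pose a i t := labp (P i (t / omega)) (Q i (t / omega)) t.
pose b i t := labq (P i (t / omega)) (Q i (t / omega)) t.
have labQ i t : labq (a i t) (b i t) t = Q i (t / omega).
  by rewrite -[RHS]mul1r -(cos2Dsin2 t) /a /b /labq /labp; ring.
have labP i t : labp (a i t) (b i t) t = P i (t / omega).
  by rewrite -[RHS]mul1r -(cos2Dsin2 t) /a /b /labq /labp; ring.
exists a, b; split; last first.
  move=> i t t0; rewrite labQ labP.
  rewrite (_ : omega * t / omega = t); last by rewrite mulrAC divff// mul1r.
  by rewrite (HQ i).1// (HP i).1.
move=> i t t0.
have t0' : 0 <= t / omega by rewrite divr_ge0// ltW.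
have cE : coupling gamma a b i t =
    \sum_(j < n | j != i) gamma i j (p j (t / omega) - p i (t / omega)).
  apply: eq_bigr => j _.
  rewrite -(HP i).1// -(HP j).1// -!labP; congr (gamma i j _); rewrite /labp; ring.
have dscale : is_derive t 1 (fun t => t / omega) omega^-1.
  rewrite (_ : (fun _ => _) = omega^-1 \*: id); last by apply/funext => s; rewrite mulrC.
  by apply: is_derive_eq; rewrite /GRing.scale/= mulr1.
have dQ := @is_derive1_comp R (Q i) (fun t => t / omega) t _ _ ((HQ i).2 _ t0') dscale.
have dP := @is_derive1_comp R (P i) (fun t => t / omega) t _ _ ((HP i).2 _ t0') dscale.
split.
- apply: is_derive_eq (is_derive_labp_comp dP dQ) _.
  by rewrite cE /labp /labq /= (HP i).1// (HQ i).1//; field.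
- apply: is_derive_eq (is_derive_labq_comp dP dQ) _.
  by rewrite cE /labp /labq /= (HP i).1// (HQ i).1//; field.
Qed.

Section Distances.
Context (q p a b : 'I_n -> R -> R) (t th : R).
Hypothesis qE : forall i, q i t = labq (a i th) (b i th) th.
Hypothesis pE : forall i, p i t = labp (a i th) (b i th) th.

Lemma enorm_lab i j : enorm (xi q p i t - xi q p j t) =
  Num.sqrt ((a i th - a j th) ^+ 2 + (b i th - b j th) ^+ 2).
Proof.
rewrite enorm_xiB -(lab_norm (a i th - a j th) (b i th - b j th) th) !qE !pE.
by congr (Num.sqrt (_ ^+ 2 + _ ^+ 2)); rewrite /labq /labp; ring.
Qed.

Lemma spread_le_max_dist D : max_dist q p t <= D -> spread_le (a ^~ th) (b ^~ th) D.
Proof.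
move=> mD i j u1 u2 uE; apply: le_trans mD.
apply: (@le_trans _ _ (enorm (xi q p i t - xi q p j t))).
  rewrite enorm_lab; apply: le_trans (ler_norm _) _; apply: dot_unit_le => //.
  by rewrite sqr_sqrtr// addr_ge0 ?sqr_ge0.
exact: (@le_bigmax _ _ _ 0 (fun ij : 'I_n * 'I_n =>
  enorm (xi q p ij.1 t - xi q p ij.2 t)) (i, j)).
Qed.

Lemma max_dist_spread_le D : 0 <= D -> spread_le (a ^~ th) (b ^~ th) D ->
  max_dist q p t <= D.
Proof.
move=> D0 ab; apply: bigmax_le => // -[i j] _ /=.
by rewrite enorm_lab; apply: norm_le_dot => u1 u2; exact: ab.
Qed.
End Distances.

End BackToOscillators.

Theorem theorem3 (R : realType) (n : nat) (gamma : 'I_n -> 'I_n -> R -> R)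
    (hconn : connected_interconnection gamma)
    (hlip : forall i j, i != j -> locally_lipschitz (gamma i j))
    (Delta delta : R) (hDelta : 0 < Delta) (hdelta : 0 < delta) :
  exists2 omega_star : R, 0 < omega_star &
  forall omega : R, omega_star <= omega ->
    [/\ (* (a) *)
        forall r : R, delta < r -> exists2 eps : R, 0 < eps &
          forall q p : 'I_n -> R -> R, array_solution gamma omega q p ->
            max_dist q p 0 <= eps ->
            forall t : R, 0 <= t -> max_dist q p t <= r,
        (* (b) *)
        forall eps : R, eps < Delta -> exists2 r : R, 0 < r &
          forall q p : 'I_n -> R -> R, array_solution gamma omega q p ->
            max_dist q p 0 <= eps ->
            forall t : R, 0 <= t -> max_dist q p t <= r
      & (* (c) *)
        forall r eps : R, r < Delta -> delta < eps -> exists2 T : R, 0 < T &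
          forall q p : 'I_n -> R -> R, array_solution gamma omega q p ->
            max_dist q p 0 <= r ->
            forall t : R, T <= t -> max_dist q p t <= eps].
Proof.
have [inter [root reach]] := hconn.
pose r := Delta + 3.
have r0 : 0 < r by rewrite addr_gt0.
(* Configurations of diameter at most Delta are followed up to radius Delta + 3:
   2 for the displacements during a period, 1 for the accumulated errors. *)
have /choice[f Hf] ij : exists L, ij.1 != ij.2 -> forall y z,
    `|y| <= r -> `|z| <= r ->
    `|gamma ij.1 ij.2 y - gamma ij.1 ij.2 z| <= L * `|y - z|.
  have [->|ij12] := eqVneq ij.1 ij.2; first by exists 0.
  have [L _ HL] := locally_lipschitz_segment r (hlip _ _ ij12).
  by exists L.
pose L := \big[Num.max/1]_ij f ij.
have L1 : 1 <= L by exact: bigmax_ge_id.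
have L0 : 0 < L by exact: lt_le_trans ltr01 L1.
have gamma_lip i j : i != j -> forall y z, `|y| <= r -> `|z| <= r ->
    `|gamma i j y - gamma i j z| <= L * `|y - z|.
  move=> ij y z yr zr; apply: le_trans (Hf (i, j) ij y z yr zr) _.
  by rewrite ler_wpM2r//; exact: le_bigmax.
have gamma_cont i j : i != j -> continuous (gamma i j).
  by move=> ij; exact: locally_lipschitz_continuous (hlip _ _ ij).
have gamma_sign i j : i != j -> forall s, 0 <= s * gamma i j s.
  by move=> ij s; have [/(_ s)[]] := inter i j ij.
have gamma_0 i j : i != j -> gamma i j 0 = 0.
  by move=> ij; have [/(_ 0)[]] := inter i j ij.
have /choice[alpha0 Halpha] ij : exists alpha, edge gamma ij.1 ij.2 ->
    class_K alpha /\ forall s, alpha `|s| <= `|gamma ij.1 ij.2 s|.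
  have [e12|ne12] := boolP (edge gamma ij.1 ij.2); last by exists id.
  have /andP[ij12 /asboolP gn0] := e12.
  have [_ [//|[alpha aK ag]]] := inter _ _ ij12.
  by exists alpha.
have gamma_alpha i j : edge gamma i j -> class_K (alpha0 (i, j)) /\
    forall s, alpha0 (i, j) `|s| <= `|gamma i j s|.
  exact: Halpha (i, j).
have [h0 h00 H] := @slow_practical_stability R n gamma L r
  (fun i j => alpha0 (i, j)) L0 r0 gamma_cont gamma_sign gamma_0 gamma_lip
  gamma_alpha root reach L1 Delta (lexx _) delta hDelta hdelta.
exists h0^-1; first by rewrite invr_gt0.
move=> omega oh.
have o0 : 0 < omega by apply: lt_le_trans oh; rewrite invr_gt0.
have hp : 0 < omega^-1 by rewrite invr_gt0.
have hh0 : omega^-1 <= h0 by rewrite -[h0]invrK lef_pV2// posrE invr_gt0.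
have [D0 [T [D00 T0 {}H]]] := H omega^-1 hp hh0.
have start q p a b D :
    (forall i t, 0 <= t ->
      q i t = labq (a i (omega * t)) (b i (omega * t)) (omega * t) /\
      p i t = labp (a i (omega * t)) (b i (omega * t)) (omega * t)) ->
    max_dist q p 0 <= D -> spread_le (a ^~ 0) (b ^~ 0) D.
  move=> qp; apply: spread_le_max_dist => i;
    by have [] := qp i 0 (lexx _); rewrite mulr0.
have finish (q p a b : 'I_n -> R -> R) t D D' :
    (forall i t, 0 <= t ->
      q i t = labq (a i (omega * t)) (b i (omega * t)) (omega * t) /\
      p i t = labp (a i (omega * t)) (b i (omega * t)) (omega * t)) ->
    0 <= t -> 0 < D -> D <= D' ->
    spread_le (a ^~ (omega * t)) (b ^~ (omega * t)) D -> max_dist q p t <= D'.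
  move=> qp t0 D0' DD ab; apply: le_trans DD.
  by apply: (max_dist_spread_le _ _ (ltW D0') ab) => i; have [] := qp i t t0.
split.
- move=> r' dr'; exists D0 => // q p sol md t t0.
  have [a [b [ab qp]]] := rotating_frame o0 sol; have [Ha _ _] := H a b ab.
  apply: (finish _ _ _ _ _ _ _ qp t0 hdelta (ltW dr')).
  by apply: Ha; [exact: start md|rewrite mulr_ge0// ltW].
- move=> eps epsD; exists (Delta + delta); first exact: addr_gt0.
  move=> q p sol md t t0.
  have [a [b [ab qp]]] := rotating_frame o0 sol; have [_ Hb _] := H a b ab.
  apply: (finish _ _ _ _ _ _ _ qp t0 (addr_gt0 hDelta hdelta) (lexx _)).
  apply: Hb; last by rewrite mulr_ge0// ltW.
  by apply: start qp _; exact: le_trans md (ltW epsD).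
- move=> r' eps rD de; exists (T / omega); first by rewrite divr_gt0.
  move=> q p sol md t Tt.
  have t0 : 0 <= t by apply: le_trans Tt; rewrite divr_ge0// ltW.
  have [a [b [ab qp]]] := rotating_frame o0 sol; have [_ _ Hc] := H a b ab.
  apply: (finish _ _ _ _ _ _ _ qp t0 hdelta (ltW de)).
  apply: Hc; last by rewrite mulrC -ler_pdivrMr.
  by apply: start qp _; exact: le_trans md (ltW rD).
Qed.
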